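(* Let $1\le n_1<n_2<\dots<n_r<n$ be integers, write $\underline{n}=\{n_1,\dots,n_r\}$, let $G=SL(n,\mathbb{C})$ and let $P$ be the parabolic subgroup with $\Delta_P=\{\alpha_i\mid i\notin\underline{n}\}$, so that $G/P=\mathrm{Fl}(\underline{n})$, with projection $\pi_P\colon G/B\to\mathrm{Fl}(\underline{n})$. Let $i\in[n-1]$. (1) If $i\in\underline{n}$, then $\pi_P(X_{\mathrm{id}}^{w_0s_iw_P})$ is the Schubert divisor of $\mathrm{Fl}(\underline{n})$ defined by the Plücker coordinate hyperplane $x_{(n-i,n]}=0$. (2) If $i\in\underline{n}$, then $\pi_P(X_{s_i}^{w_0w_P})$ is the Schubert divisor of $\mathrm{Fl}(\underline{n})$ defined by the Plücker coordinate hyperplane $x_{[i]}=0$. (3) If $i<n_1$, then $\pi_P(X_{s_i}^{w_0w_P})$ is given by $x_{[i],(n-n_1+i,n]}=0$. (4) If $i>n_r$, then $\pi_P(X_{s_i}^{w_0w_P})$ is given by $x_{(i-n_r,i]}=0$. (5) If $n_j<i<n_{j+1}$ for some $j\in[r-1]$, set $k:=i-n_j$ and $l:=\min\{i,\,n-n_{j+1}+k\}$. Then $\pi_P(X_{s_i}^{w_0w_P})$ is given by $$\sum_{J\in\binom{[l]}{k}}(-1)^{|J|}\,x_{[i]\setminus J}\cdot x_{J,(n-n_{j+1}+k,n]}=0,$$ where $|J|$ denotes the sum of the elements of $J$.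
   Context: $W=S_n$ with simple transpositions $s_i=s_{\alpha_i}$, $i\in[n-1]$; $w_0$ is the longest element of $S_n$ and $w_P$ the longest element of the subgroup $W_P$ generated by $s_i$, $i\notin\underline n$. $B$ is a Borel subgroup, $B^-=w_0Bw_0$; $X_u$ (resp. $X^u$) denotes the closure of $B^-uB/B$ (resp. $BuB/B$) in $G/B$, and $X_v^u=X_v\cap X^u$. $\mathrm{Fl}(\underline n)$ is the variety of flags $F_{n_1}\subset\dots\subset F_{n_r}\subset\mathbb{C}^n$ with $\dim F_{n_j}=n_j$. A point is represented by a full-rank $n_r\times n$ matrix whose first $n_j$ rows span $F_{n_j}$. For $m\ge1$, $[m]=\{1,\dots,m\}$, $(a,b]=\{a+1,\dots,b\}$, $\binom{[m]}{j}$ is the set of $j$-element subsets of $[m]$; for disjoint index sets $J,J'$, ''$J,J'$'' denotes $J\cup J'$. For $J\subset[n]$ with $|J|=n_j$, the Plücker coordinate $x_J$ is the minor of the first $n_j$ rows in the columns $J$ (columns taken in increasing order). Conventions: the hypersurface $X_{s_i}$ of the complete flag variety $G/B$ is defined by $x_{[i]}=0$, and the dense Schubert cell $\pi_P(\mathring X^{w_0w_P})$ of $\mathrm{Fl}(\underline n)$ consists of the flags represented by the $n_r\times n$ matrices which, with row blocks of sizes $a_1=n_1,a_2=n_2-n_1,\dots,a_r=n_r-n_{r-1}$ and column blocks (left to right) of sizes $n-n_r,a_r,a_{r-1},\dots,a_1$, have an identity matrix $I_{a_s}$ in row block $s$ and column block $r+2-s$, arbitrary entries to its left and zeros to its right.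 ''Given by'' an equation means cut out in $\mathrm{Fl}(\underline n)$ by that equation. *)

(* Defs.v *)
From HB Require Import structures.
From mathcomp Require Import all_boot all_order all_algebra all_fingroup.
From mathcomp Require Import reals complex mpoly.
Set Implicit Arguments. Unset Strict Implicit. Unset Printing Implicit Defensive.
Import GRing.Theory Num.Theory.
Local Open Scope ring_scope.

Section Flags.
Variable C : fieldType.

(* safe entry lookup with 0-indexed nat indices (0 outside the matrix) *)
Definition mget p q (A : 'M[C]_(p, q)) (a b : nat) : C :=
  match insub a, insub b with Some i, Some j => A i j | _, _ => 0 end.

Definition toprows p q (m : nat) (A : 'M[C]_(p, q)) : 'M[C]_(m, q) :=
  \matrix_(a < m, b < q) mget A a b.

(* Pluecker coordinate x_J of a point of Fl(n) represented by the matrix M: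
   J is a set of 1-indexed column indices (given as a duplicate-free list);
   x_J = minor of M on its first |J| rows and the columns of J in increasing order. *)
Definition plucker p q (M : 'M[C]_(p, q)) (J : seq nat) : C :=
  let s := sort leq J in
  \det (\matrix_(a < size s, b < size s) mget M a (nth 0 s b).-1).

Variable n : nat.

Definition mxpt (g : 'M[C]_n) : 'I_(n * n) -> C := fun k => mxvec g 0 k.
Definition zclosure (S : 'M[C]_n -> Prop) (g : 'M[C]_n) : Prop :=
  forall P : {mpoly C[n * n]},
    (forall h, S h -> P.@[mxpt h] = 0) -> P.@[mxpt g] = 0.

Definition upper (b : 'M[C]_n) : Prop :=
  forall i j : 'I_n, (j < i)%N -> b i j = 0.
Definition lower (b : 'M[C]_n) : Prop :=
  forall i j : 'I_n, (i < j)%N -> b i j = 0.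
Definition inB (b : 'M[C]_n) : Prop := upper b /\ b \in unitmx.
Definition inBm (b : 'M[C]_n) : Prop := lower b /\ b \in unitmx.
Definition inSL (g : 'M[C]_n) : Prop := \det g = 1.

(* matrix of the permutation w : e_j |-> e_{w j} *)
Definition pmat (w : 'S_n) : 'M[C]_n := perm_mx w^-1.

(* preimages in G = SL(n) of the Schubert cells B^- w B/B and B w B/B *)
Definition cell_opp (w : 'S_n) (g : 'M[C]_n) : Prop :=
  inSL g /\ exists bm b, [/\ inBm bm, inB b & g = bm *m pmat w *m b].
Definition cell_std (w : 'S_n) (g : 'M[C]_n) : Prop :=
  inSL g /\ exists b1 b2, [/\ inB b1, inB b2 & g = b1 *m pmat w *m b2].

(* preimages in G of X_w (closure of B^- w B/B) and X^w (closure of B w B/B) *)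
Definition Xlow (w : 'S_n) (g : 'M[C]_n) : Prop := inSL g /\ zclosure (cell_opp w) g.
Definition Xup (w : 'S_n) (g : 'M[C]_n) : Prop := inSL g /\ zclosure (cell_std w) g.
Definition Richardson (v u : 'S_n) (g : 'M[C]_n) : Prop := Xlow v g /\ Xup u g.

(* Fl(ns): a point is a full-rank (last ns) x n matrix; gB |-> the flag whose
   n_j-dimensional member is spanned by the first n_j columns of g, i.e. by the
   first n_j rows of g^T. *)
Definition nr (ns : seq nat) := last 0%N ns.
Definition sameflag (ns : seq nat) (M : 'M[C]_(nr ns, n)) (g : 'M[C]_n) : Prop :=
  forall m, m \in ns -> (toprows m M == toprows m g^T)%MS.
(* membership of the point M of Fl(ns) in pi_P(X), for X a subset of G/B
   given by its (right B-invariant) preimage in G *)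
Definition inproj (ns : seq nat) (X : 'M[C]_n -> Prop) (M : 'M[C]_(nr ns, n)) : Prop :=
  exists g, X g /\ sameflag M g.
Definition given_by (ns : seq nat) (X : 'M[C]_n -> Prop)
  (f : 'M[C]_(nr ns, n) -> C) : Prop :=
  forall M : 'M[C]_(nr ns, n), \rank M = nr ns -> (inproj X M <-> f M = 0).
End Flags.

(* simple transposition s_i (1-indexed, i in [n-1]) swapping i and i+1 *)
Definition simp (n i : nat) : 'S_n :=
  match insub i.-1 : option 'I_n, insub i : option 'I_n with
  | Some a, Some b => if (0 < i)%N then tperm a b else 1%g
  | _, _ => 1%g end.
(* Coxeter length in S_n = number of inversions *)
Definition ninv n (w : 'S_n) : nat :=
  #|[set p : 'I_n * 'I_n | (p.1 < p.2)%N && (w p.2 < w p.1)%N]|.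
Definition w0 (n : nat) : 'S_n := [arg max_(w > 1%g) ninv w].
Definition WP (n : nat) (ns : seq nat) : {set 'S_n} :=
  <<[set simp n i | i : 'I_n & (0 < i)%N && (val i \notin ns)]>>%g.
Definition wP (n : nat) (ns : seq nat) : 'S_n :=
  [arg max_(w > 1%g in WP n ns) ninv w].
(* product u.v in the Weyl group as composition of functions (u after v);
   note MathComp's (v * u) x = u (v x) *)
Definition wmul n (u v : 'S_n) : 'S_n := (v * u)%g.

(* Main.v *)
Require Import Defs.
From HB Require Import structures.
From mathcomp Require Import all_boot all_order all_algebra all_fingroup.
From mathcomp Require Import reals complex mpoly zify.
Set Implicit Arguments. Unset Strict Implicit. Unset Printing Implicit Defensive.
Import GRing.Theory Num.Theory.
Local Open Scope ring_scope.

(** A matrix of SL(n) lies in the Schubert variety [X^w] iff every lower left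
    corner has rank at most that of the permutation matrix of [w]: reduce the
    matrix by Bruhat decomposition to a permutation [v], and climb from [v] to
    [w] by transpositions, each step being a degeneration along a line. The
    opposite varieties follow by multiplication with [w0].

    For [w = w0 wP] the rank conditions on a full flag extending a partial flag
    follow from those at the prescribed dimensions, since inside each block the
    columns may be reordered to make the permutation increasing. So a point of
    [Fl(n)] lies in the projection of [X_{s_i}^w] iff it has an intermediate
    [i]-dimensional member [F] with [A <= F <= B], where [A] and [B] are the
    neighbouring members of dimensions [a] and [b], such that [F] meets
    [<e_1..e_q>], [q = n - b + (i - a)], in dimension at least [i - a], and meets
    [<e_{i+1}..e_n>] nontrivially. Such an [F] exists iff there is a nonzero pair
    [(u, v)] in [A x (B cap <e_1..e_q>)] with [u + v] in [<e_{i+1}..e_n>]; this is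
    the kernel of a square matrix whose determinant, expanded along the rows of
    [A], is the stated polynomial in Pluecker coordinates. *)

(** * Zariski closure and regular functions *)

(** The closure is tested by polynomials on all n x n matrices, whereas the cells lie in SL(n),
    which elimination to a permutation matrix does not respect. The rank criterion is therefore
    proved for cells of GL(n); scaling one column, which moves no flag, leads back to determinant 1.
    The projection asks for a full matrix satisfying every corner condition, while a point of the
    partial flag variety controls only its prescribed members; the remaining columns have to be
    chosen well. Origin of q: w0 wP sends the positions (a, i] to the values (n-b, q] and the
    positions up to a to the last a values, so exactly a of the first i positions have a value above
    q. For F of dimension i the corner condition thus reads dim(F cap <e_1..e_q>) >= i - a. The pair
    (u, v) has a + b coordinates, subject to i equations on u + v and n - q equations on v; as n - q
    = a + b - i, the matrix is square. *)

Section RegularFunctions.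
Variables (C : numFieldType) (n : nat).
Implicit Types (F G : 'M[C]_n -> C) (S T : 'M[C]_n -> Prop) (g h : 'M[C]_n).

(** Stated extensionally, so that regularity follows from closure rules without writing any
    polynomial down. *)
Definition regular F := exists Q : {mpoly C[n * n]}, forall h, Q.@[mxpt h] = F h.

Lemma regular_ext F G : F =1 G -> regular F -> regular G.
Proof. by move=> eqFG [Q HQ]; exists Q => h; rewrite HQ eqFG. Qed.

Lemma regular_const c : regular (fun=> c).
Proof. by exists c%:MP => h; rewrite mevalC. Qed.

Lemma regular_entry i j : regular (fun h => h i j).
Proof.
exists 'X_(mxvec_index i j) => h.
by rewrite mevalXU /mxpt mxvecE.
Qed.

Lemma regularD F G : regular F -> regular G -> regular (fun h => F h + G h).
Proof. by move=> [P HP] [Q HQ]; exists (P + Q) => h; rewrite mevalD HP HQ. Qed.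

Lemma regularM F G : regular F -> regular G -> regular (fun h => F h * G h).
Proof. by move=> [P HP] [Q HQ]; exists (P * Q) => h; rewrite mevalM HP HQ. Qed.

Lemma regularX F k : regular F -> regular (fun h => F h ^+ k).
Proof.
move=> rF; elim: k => [|k IH]; first exact: regular_const.
by apply: regular_ext (regularM rF IH) => h; rewrite exprS.
Qed.

Lemma regular_sum (I : Type) (r : seq I) (P : pred I) (F : I -> 'M[C]_n -> C) :
  (forall i, P i -> regular (F i)) -> regular (fun h => \sum_(i <- r | P i) F i h).
Proof.
move=> rF; elim: r => [|i r IH].
  by apply: regular_ext (regular_const 0) => h; rewrite big_nil.
case Pi: (P i); last by apply: regular_ext IH => h; rewrite big_cons Pi.
by apply: regular_ext (regularD (rF i Pi) IH) => h; rewrite big_cons Pi.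
Qed.

Lemma regular_prod (I : Type) (r : seq I) (P : pred I) (F : I -> 'M[C]_n -> C) :
  (forall i, P i -> regular (F i)) -> regular (fun h => \prod_(i <- r | P i) F i h).
Proof.
move=> rF; elim: r => [|i r IH].
  by apply: regular_ext (regular_const 1) => h; rewrite big_nil.
case Pi: (P i); last by apply: regular_ext IH => h; rewrite big_cons Pi.
by apply: regular_ext (regularM (rF i Pi) IH) => h; rewrite big_cons Pi.
Qed.

Lemma regular_det m (A : 'M[C]_n -> 'M[C]_m) :
  (forall i j, regular (fun h => A h i j)) -> regular (fun h => \det (A h)).
Proof.
move=> rA; apply: regular_sum => s _.
by apply: regularM; [exact: regular_const | exact: regular_prod].
Qed.

Lemma regular_mul m1 m2 (X : 'M[C]_(m1, n)) (Y : 'M[C]_(n, m2)) i j :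
  regular (fun h => (X *m h *m Y) i j).
Proof.
have r1 k : regular (fun h => (X *m h) i k).
  apply: (@regular_ext (fun h => \sum_a X i a * h a k)) => [h|]; first by rewrite mxE.
  by apply: regular_sum => a _; apply: regularM; [exact: regular_const | exact: regular_entry].
apply: (@regular_ext (fun h => \sum_k (X *m h) i k * Y k j)) => [h|]; first by rewrite mxE.
by apply: regular_sum => a _; apply: regularM => //; exact: regular_const.
Qed.

Lemma zclosure_regular S g F :
  zclosure S g -> regular F -> (forall h, S h -> F h = 0) -> F g = 0.
Proof. by move=> Zg [Q HQ] F0; rewrite -HQ; apply: Zg => h /F0; rewrite HQ. Qed.

Lemma sub_zclosure S g : S g -> zclosure S g.
Proof. by move=> Sg P; apply. Qed.

Lemma zclosure_trans S T g :
  (forall h, S h -> zclosure T h) -> zclosure S g -> zclosure T g.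
Proof. by move=> ST Sg P P0; apply: Sg => h /ST; apply. Qed.

(** Substituting a regular map into a polynomial gives a regular function: such maps are continuous
    for the Zariski topology. *)
Lemma zclosure_image S T (f : 'M[C]_n -> 'M[C]_n) g :
  (forall i j, regular (fun h => f h i j)) -> (forall h, S h -> T (f h)) ->
  zclosure S g -> zclosure T (f g).
Proof.
move=> rf ST Sg P P0.
apply: (zclosure_regular (F := fun h => P.@[mxpt (f h)]) Sg) => [|h /ST /P0 //].
apply: (@regular_ext (fun h => \sum_(m <- msupp P) P@_m * \prod_k mxpt (f h) k ^+ m k)).
  by move=> h; rewrite mevalE.
apply: regular_sum => m _; apply: regularM; first exact: regular_const.
apply: regular_prod => k _; apply: regularX.
case/mxvec_indexP: k => i j.
by apply: regular_ext (rf i j) => h; rewrite /mxpt mxvecE.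
Qed.

Lemma zclosure_mul S T (X Y : 'M[C]_n) g :
  (forall h, S h -> T (X *m h *m Y)) -> zclosure S g -> zclosure T (X *m g *m Y).
Proof. by apply: (@zclosure_image S T (fun h => X *m h *m Y)) => i j; exact: regular_mul. Qed.

(** In a [numFieldType] the values 1, ..., [size p] are distinct nonzero roots, too many for a
    nonzero [p]. *)
Lemma poly_vanish_off0 (p : {poly C}) : (forall t, t != 0 -> p.[t] = 0) -> p.[0] = 0.
Proof.
move=> p0; suff -> : p = 0 by rewrite horner0.
apply/eqP; apply/negPn/negP => nz.
have /(max_poly_roots nz) : all (root p) [seq k.+1%:R | k <- iota 0 (size p)].
  by apply/allP => _ /mapP[k _ ->]; apply/rootP/p0; rewrite pnatr_eq0.
rewrite map_inj_uniq ?iota_uniq; last by move=> x y /eqP; rewrite eqr_nat => /eqP[].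
by rewrite size_map size_iota ltnn => /(_ isT).
Qed.

(** Along the line a polynomial becomes univariate in [t], so its value at 0 is forced by the values
    elsewhere. *)
Lemma zclosure_line S g X :
  (forall t, t != 0 -> S (g + t *: X)) -> zclosure S g.
Proof.
move=> St P P0.
pose p : {poly C} := \sum_(m <- msupp P) P@_m *:
  \prod_k ((mxpt g k)%:P + (mxpt X k) *: 'X) ^+ m k.
have pE t : p.[t] = P.@[mxpt (g + t *: X)].
  rewrite mevalE horner_sum; apply: eq_bigr => m _.
  rewrite hornerZ horner_prod; congr (_ * _); apply: eq_bigr => k _.
  rewrite horner_exp !hornerE; congr (_ ^+ _).
  by rewrite /mxpt linearD linearZ !mxE mulrC.
have := @poly_vanish_off0 p; rewrite pE scale0r addr0; apply => t t0.
by rewrite pE; apply/P0/St.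
Qed.

(* The column rescaling h |-> h * diag(1/det h, 1, ...) is only rational in h; multiplying
   P of it by a power of det h gives a regular function. *)
Lemma zclosure_normalize S T (D : C -> 'M[C]_n) g :
  (forall h, S h -> h \in unitmx) ->
  (forall h, S h -> T (h *m D (\det h)^-1)) ->
  D 1 = 1%:M -> (forall i j, exists c d, forall t, D t i j = c + t * d) ->
  \det g = 1 -> zclosure S g -> zclosure T g.
Proof.
move=> Su ST D1 Daff dg Sg P P0.
have [b [rb bE]] : exists b : 'I_(n * n) -> 'M[C]_n -> C, (forall k, regular (b k)) /\
    (forall h k, h \in unitmx -> b k h = mxpt (h *m D (\det h)^-1) k * \det h).
  have [b Hb] : exists b : 'I_(n * n) -> 'M[C]_n -> C, forall k, regular (b k) /\
      (forall h, h \in unitmx -> b k h = mxpt (h *m D (\det h)^-1) k * \det h).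
    apply: (@fin_all_exists _ _ (fun k (f : 'M[C]_n -> C) => regular f /\
      (forall h, h \in unitmx -> f h = mxpt (h *m D (\det h)^-1) k * \det h))) => k.
    case/mxvec_indexP: k => i j.
    have [c Hc] := fin_all_exists (fun k => Daff k j).
    have [d Hd] := fin_all_exists Hc.
    exists (fun h => \sum_k h i k * (\det h * c k + d k)); split.
      apply: regular_sum => k _; apply: regularM; first exact: regular_entry.
      apply: regularD; last exact: regular_const.
      apply: regularM; last exact: regular_const.
      by apply: regular_det => x y; apply: regular_entry.
    move=> h; rewrite unitmxE unitfE => h0.
    rewrite /mxpt mxvecE mxE mulr_suml; apply: eq_bigr => k _.
    by rewrite Hd -mulrA mulrDl (mulrC _^-1) divfK // (mulrC (c k)).
  by exists b; split=> [k|h k]; [case: (Hb k) | case: (Hb k) => _; apply].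
(* A monomial of degree d in the [b k h] carries [det h ^+ d]; the factor [det h ^+ (N - d)] gives
   all terms the same power. Every degree occurring in [P] is below [msize P], so the [else] branch
   is a default never reached. *)
pose N := msize P.
pose F h := \sum_(m <- msupp P) (if (mdeg m < N)%N then
   P@_m * (\det h ^+ (N - mdeg m) * \prod_k b k h ^+ m k) else 0).
have FE h : h \in unitmx -> F h = \det h ^+ N * P.@[mxpt (h *m D (\det h)^-1)].
  move=> hu; rewrite mevalE mulr_sumr [RHS]big_seq [LHS]big_seq.
  apply: eq_bigr => m mP; rewrite msize_mdeg_lt // [RHS]mulrCA; congr (_ * _).
  under eq_bigr => k _ do rewrite bE // exprMn.
  rewrite big_split /= mulrCA mulrC; congr (_ * _).
  rewrite prodrXr -mdegE -exprD subnK //.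
  by rewrite ltnW // msize_mdeg_lt.
have gu : g \in unitmx by rewrite unitmxE dg unitr1.
have : F g = 0.
  apply: (zclosure_regular Sg) => [|h Sh]; last first.
    by rewrite FE ?(P0 _ (ST h Sh)) ?mulr0 //; exact: Su.
  apply: regular_sum => m _; case: (mdeg m < N)%N; last exact: regular_const.
  apply: regularM; first exact: regular_const.
  apply: regularM; last by apply: regular_prod => k _; exact: regularX.
  by apply: regularX; apply: regular_det => x y; apply: regular_entry.
by rewrite FE // dg expr1n invr1 D1 mulmx1 mul1r.
Qed.
End RegularFunctions.

(** * Rank conditions *)

Section RankConditions.
Variables (C : fieldType) (n : nat).
Implicit Types (g h b : 'M[C]_n) (v w : 'S_n).

Lemma pid_diagE p : pid_mx p = diag_mx (\row_j (j < p)%:R) :> 'M[C]_n.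
Proof.
apply/matrixP => i j; rewrite !mxE; rewrite -val_eqE /=.
by case: eqVneq; case: (_ < _)%N; rewrite ?mulr1n ?mulr0n.
Qed.

Lemma copid_diagE p : copid_mx p = diag_mx (\row_j (p <= j)%:R) :> 'M[C]_n.
Proof.
apply/matrixP => i j; rewrite /copid_mx pid_diagE !mxE ltnNge.
by case: eqVneq => [->|_]; case: (_ <= _)%N; rewrite ?mulr1n ?mulr0n ?subrr ?subr0.
Qed.

Lemma cornerE p q g i j :
  (copid_mx q *m g *m pid_mx p) i j = if (q <= i)%N && (j < p)%N then g i j else 0.
Proof.
rewrite pid_diagE copid_diagE mul_mx_diag mul_diag_mx !mxE.
by case: (_ <= _)%N; case: (_ < _)%N; rewrite ?mulr1 ?mul1r ?mul0r ?mulr0.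
Qed.

Lemma pid_idem p : (pid_mx p : 'M[C]_n) *m pid_mx p = pid_mx p :> 'M[C]_n.
Proof. by rewrite mul_pid_mx minnn pid_mx_minv. Qed.

Lemma pid_copid p : pid_mx p *m copid_mx p = 0 :> 'M[C]_n.
Proof. by rewrite /copid_mx mulmxBr mulmx1 pid_idem subrr. Qed.

(** Upper triangular means that each span of the first [p] basis vectors is stable. As an identity
    of products this passes to products and inverses without looking at entries. *)
Lemma upperP b : upper b <-> forall p, copid_mx p *m b *m pid_mx p = 0 :> 'M[C]_n.
Proof.
split=> [ub p|ub i j ltji].
  apply/matrixP => i j; rewrite cornerE mxE; case: ifP => // /andP[pi jp].
  by apply: ub; apply: leq_trans pi.
by have /matrixP/(_ i j) := ub i; rewrite cornerE mxE leqnn ltji.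
Qed.

Lemma upper_pid b p : upper b -> b *m pid_mx p = pid_mx p *m b *m pid_mx p :> 'M[C]_n.
Proof.
move/upperP/(_ p); rewrite /copid_mx mulmxBl mul1mx mulmxBl => /eqP.
by rewrite subr_eq0 => /eqP.
Qed.

Lemma copid_upper b q : upper b -> copid_mx q *m b = copid_mx q *m b *m copid_mx q :> 'M[C]_n.
Proof. by move/upperP/(_ q) => ub; rewrite {3}/copid_mx mulmxBr mulmx1 ub subr0. Qed.

Lemma upper_mul b b' : upper b -> upper b' -> upper (b *m b').
Proof.
move=> ub ub'; apply/upperP => p.
by rewrite mulmxA copid_upper // -!mulmxA (mulmxA (copid_mx p) b') (upperP b').1 // !mulmx0.
Qed.

Lemma stable_eqmx (P U : 'M[C]_n) : U \in unitmx -> (P *m U <= P)%MS -> (P *m U == P)%MS.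
Proof.
move=> uU sPU; rewrite -(geq_leqif (mxrank_leqif_eq sPU)) mxrankMfree //.
by rewrite row_free_unit.
Qed.

(** An invertible map sending a subspace into itself maps it onto itself, so the inverse stabilises
    the same flag. The argument is transposed because subspaces are row spaces. *)
Lemma upper_inv b : upper b -> b \in unitmx -> upper (invmx b).
Proof.
move=> ub bU; apply/upperP => p; apply: trmx_inj; rewrite trmx0 !trmx_mul.
rewrite trmx_inv tr_pid_mx /copid_mx linearB /= trmx1 tr_pid_mx -/(copid_mx p) mulmxA.
have uT : b^T \in unitmx by rewrite unitmx_tr.
have : ((pid_mx p : 'M[C]_n) *m b^T <= (pid_mx p : 'M[C]_n))%MS.
  have /(congr1 trmx) := upper_pid p ub.
  rewrite !trmx_mul tr_pid_mx => ->; rewrite mulmxA; exact: submxMl.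
move/(stable_eqmx uT)/andP => [_ /(submxMr (invmx b^T))].
rewrite -mulmxA mulmxV // mulmx1 => /submxP[X ->].
by rewrite -mulmxA pid_copid mulmx0.
Qed.

Lemma inB1 : inB (1%:M : 'M[C]_n).
Proof.
split; last exact: unitmx1.
by move=> i j ltji; rewrite mxE -val_eqE /= gtn_eqF.
Qed.

Lemma inB_mul b b' : inB b -> inB b' -> inB (b *m b').
Proof. by move=> [u1 v1] [u2 v2]; split; [exact: upper_mul | rewrite unitmx_mul v1]. Qed.

Lemma inB_inv b : inB b -> inB (invmx b).
Proof. by move=> [u1 v1]; split; [exact: upper_inv | rewrite unitmx_inv]. Qed.

(** Rank of the lower left corner (rows from [q] on, first [p] columns), kept at size [n] to avoid
    dependent dimensions. An upper triangular factor on the left adds lower rows to higher ones, on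
    the right earlier columns to later ones, so neither can increase it. *)
Definition rk g p q := \rank (copid_mx q *m g *m pid_mx p : 'M[C]_n).

Lemma rk_upper b1 b2 g p q : upper b1 -> upper b2 -> (rk (b1 *m g *m b2) p q <= rk g p q)%N.
Proof.
move=> u1 u2; rewrite /rk.
have -> : copid_mx q *m (b1 *m g *m b2) *m pid_mx p =
    (copid_mx q *m b1) *m (copid_mx q *m g *m pid_mx p) *m (b2 *m pid_mx p) :> 'M[C]_n.
  rewrite (upper_pid p u2) !mulmxA {1}(copid_upper q u1) -!mulmxA; do 4 congr (_ *m _).
  by rewrite !mulmxA pid_idem -(upper_pid p u2).
by apply: leq_trans (mxrankM_maxl _ _) _; exact: mxrankM_maxr.
Qed.

Definition cnt w p q : nat := #|[set a : 'I_n | (a < p)%N && (q <= w a)%N]|.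

(** The indicators of [S] and of its complement have ranks at most the two cardinals, while their
    sum is the identity; so both bounds are attained. *)
Lemma rank_indicator (S : {set 'I_n}) :
  \rank (diag_mx (\row_j (j \in S)%:R) : 'M[C]_n) = #|S|.
Proof.
pose D (T : {set 'I_n}) := diag_mx (\row_j (j \in T)%:R) : 'M[C]_n.
have leD T : (\rank (D T) <= #|T|)%N.
  have -> : D T = \sum_(j in T) delta_mx j j.
    apply/matrixP => i j; rewrite summxE !mxE.
    case: (boolP (i \in T)) => iT; last first.
      rewrite mul0rn big1 // => k kT; rewrite mxE.
      by case: eqVneq => // ik; rewrite ik kT in iT.
    rewrite (bigD1 i) //= big1 => [|k /andP[_ ki]]; rewrite mxE ?eqxx.
      by rewrite addr0 /= eq_sym; case: eqVneq.
    by rewrite eq_sym (negbTE ki).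
  rewrite -sum1_card; elim/big_ind2: _ => [|A a B b Aa Bb|j _]; first by rewrite mxrank0.
    exact: leq_trans (mxrank_add _ _) (leq_add Aa Bb).
  by rewrite mxrank_delta.
apply/eqP; rewrite eqn_leq leD /=.
have : (n <= \rank (D S) + \rank (D (~: S)))%N.
  rewrite -{1}(@mxrank1 C n); apply: leq_trans (mxrank_add _ _).
  apply: eq_leq; congr mxrank; apply/matrixP => i j; rewrite !mxE inE.
  by case: (i \in S); rewrite ?mul0rn ?addr0 ?add0r.
rewrite -{1}(card_ord n) -(cardC S) => /leq_trans/(_ (leq_add (leqnn _) (leD _))).
have -> : #|[predC S]| = #|~: S| by apply: eq_card => x; rewrite !inE.
by rewrite leq_add2r.
Qed.

Lemma pmatE w i j : (pmat C w) i j = (i == w j)%:R.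
Proof. by rewrite !mxE; congr (nat_of_bool _)%:R; rewrite -(inj_eq (@perm_inj _ w)) permKV. Qed.

Lemma pmat_unit w : pmat C w \in unitmx.
Proof. exact: unitmx_perm. Qed.

Lemma pmatM v w : pmat C (v * w)%g = pmat C w *m pmat C v.
Proof. by rewrite /pmat invMg perm_mxM. Qed.

Lemma rk_pmat w p q : rk (pmat C w) p q = cnt w p q.
Proof.
rewrite /cnt -(rank_indicator) /rk.
rewrite -[RHS](mxrankMfree _ (B := pmat C w^-1)); last by rewrite row_free_unit pmat_unit.
rewrite -mxrank_tr; congr mxrank; apply/matrixP => i j.
rewrite mxE cornerE pmatE mul_diag_mx mxE pmatE mxE inE.
rewrite -(inj_eq (@perm_inj _ w^-1)) permK eq_sym.
case: eqVneq => [->|ne]; rewrite ?permKV ?mulr1 ?mulr0 /= ?if_same //.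
by rewrite andbC; case: ifP.
Qed.

(** Turns a rank bound into the vanishing of polynomials in [A], which makes it a closed condition.
    If the rank reaches [r], suitable base changes give [X] and [Y] with product the identity. *)
Lemma rank_lt_det m1 m2 (A : 'M[C]_(m1, m2)) r :
  (\rank A < r)%N <->
  forall (X : 'M[C]_(r, m1)) (Y : 'M[C]_(m2, r)), \det (X *m A *m Y) = 0.
Proof.
split=> [rA X Y|detA].
  apply/eqP; rewrite -[_ == 0]negbK -unitfE -unitmxE; apply/negP => /mxrank_unit rk.
  have : (\rank (X *m A *m Y) <= \rank A)%N.
    by apply: leq_trans (mxrankM_maxl _ _) _; exact: mxrankM_maxr.
  by rewrite rk leqNgt rA.
rewrite ltnNge; apply/negP => rA.
have r1 : (r <= m1)%N := leq_trans rA (rank_leq_row A).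
have r2 : (r <= m2)%N := leq_trans rA (rank_leq_col A).
have := detA (pid_mx r *m invmx (col_ebase A)) (invmx (row_ebase A) *m pid_mx r).
rewrite -{2}(mulmx_ebase A) -!mulmxA mulKmx ?col_ebase_unit // mulKVmx ?row_ebase_unit //.
rewrite !mulmxA mul_pid_mx mul_pid_mx.
have -> : minn m2 (minn (minn m1 (minn r (\rank A))) r) = r by lia.
by rewrite pid_mx_1 det1 => /eqP; rewrite oner_eq0.
Qed.
End RankConditions.

(** * Bruhat decomposition *)

Section Bruhat.
Variables (C : fieldType) (n : nat).
Implicit Types (g h b : 'M[C]_n) (v w : 'S_n).

(** The cell in GL(n): without a determinant condition it is stable under all of B on both sides. *)
Definition bcell w h := exists b1 b2, [/\ inB b1, inB b2 & h = b1 *m pmat C w *m b2].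

Lemma upper_unit b : upper b -> (forall i, b i i != 0) -> inB b.
Proof.
move=> ub bd; split=> //; rewrite unitmxE -det_tr det_trig; last first.
  by apply/is_trig_mxP => i j ij; rewrite mxE ub.
by rewrite unitfE; apply/prodf_neq0 => i _; rewrite mxE.
Qed.

Lemma mul_pmat m (A : 'M[C]_(m, n)) w i j : (A *m pmat C w) i j = A i (w j).
Proof.
rewrite mxE (bigD1 (w j)) //= pmatE eqxx mulr1 big1 ?addr0 // => k kj.
by rewrite pmatE (negbTE kj) mulr0.
Qed.

Lemma unit_col_neq0 h c : h \in unitmx -> exists i, h i c != 0.
Proof.
move=> hU; apply/existsP; apply/contraT; rewrite negb_exists => /forallP hc.
have /(congr1 (mulmx (invmx h))) : h *m delta_mx c c = 0.
  apply/matrixP => i j; rewrite mxE [RHS]mxE big1 // => k _; rewrite mxE.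
  case: eqVneq => [->|_]; last by rewrite mulr0.
  by have := hc i; rewrite negbK => /eqP ->; rewrite mul0r.
rewrite mulKmx // mulmx0 => /matrixP/(_ c c)/eqP.
by rewrite !mxE !eqxx oner_eq0.
Qed.

(* One step of Gaussian elimination by upper triangular row and column operations,
   pivoting on the lowest nonzero entry of the column. *)
Lemma bruhat_pivot h (c0 : 'I_n) (Q : 'I_n -> 'I_n) : h \in unitmx ->
  (forall c : 'I_n, (c < c0)%N -> (forall i, h i c = (i == Q c)%:R) /\ (forall j, h (Q c) j = (j == c)%:R)) ->
  exists b1 b2 q, [/\ inB b1, inB b2,
    (forall i, (b1 *m h *m b2) i c0 = (i == q)%:R) /\
    (forall j, (b1 *m h *m b2) q j = (j == c0)%:R) &
    (forall c : 'I_n, (c < c0)%N -> (forall i, (b1 *m h *m b2) i c = (i == Q c)%:R) /\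
       (forall j, (b1 *m h *m b2) (Q c) j = (j == c)%:R))].
Proof.
move=> hU inv; have [i0 hi0] := unit_col_neq0 c0 hU.
case: (arg_maxnP (P := fun i => h i c0 != 0) (fun i : 'I_n => nat_of_ord i) hi0) => q hq qmax.
have below (i : 'I_n) : (q < i)%N -> h i c0 = 0.
  by move=> qi; apply/eqP/contraT => /qmax /=; rewrite leqNgt qi.
set al := h q c0 in hq.
have Qc0 (c : 'I_n) : (c < c0)%N -> h (Q c) c0 = 0.
  move=> cc; rewrite (inv c cc).2; case: eqVneq => // e.
  by rewrite e ltnn in cc.
have qQ (c : 'I_n) : (c < c0)%N -> (q == Q c) = false.
  by move=> cc; apply/negP => /eqP e; move: hq; rewrite /al e Qc0 ?eqxx.
have hq0 (c : 'I_n) : (c < c0)%N -> h q c = 0 by move=> cc; rewrite (inv c cc).1 qQ.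
(* [L] normalises the pivot and clears column [c0] above it; it is upper triangular because nothing
   lies below the pivot. [R] clears row [q] to the right of [c0]; it is upper triangular because the
   row already vanishes to the left. *)
pose L : 'M[C]_n := \matrix_(i, j) (if j == q then (if i == q then al^-1 else - (h i c0 / al))
   else (i == j)%:R).
pose R : 'M[C]_n := \matrix_(i, j) (if (i == c0) && (j != c0) then - (al^-1 * h q j)
   else (i == j)%:R).
have LE i j : (L *m h) i j = if i == q then al^-1 * h q j else h i j - h i c0 / al * h q j.
  rewrite mxE (bigD1 q) //= !mxE eqxx.
  case: (eqVneq i q) => [->|iq].
    rewrite big1 ?addr0 // => k kq; rewrite mxE (negbTE kq) eq_sym (negbTE kq) mul0r //.
  rewrite (bigD1 i) //= mxE (negbTE iq) eqxx mul1r big1 ?addr0.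
    by rewrite mulNr addrC.
  by move=> k /andP[kq ki]; rewrite mxE (negbTE kq) eq_sym (negbTE ki) mul0r.
have LE0 i : (L *m h) i c0 = (i == q)%:R.
  rewrite LE; case: eqVneq => _; first by rewrite mulVf.
  by rewrite divfK // subrr.
have RE i j : (L *m h *m R) i j = if j == c0 then (i == q)%:R else
    if i == q then 0 else h i j - h i c0 / al * h q j.
  rewrite mxE; case: (eqVneq j c0) => [->|jc].
    rewrite (bigD1 c0) //= LE0 [R c0 c0]mxE !eqxx andbF mulr1 big1 ?addr0 // => k kc.
    by rewrite [R k c0]mxE (negbTE kc) mulr0.
  rewrite (bigD1 c0) //= (bigD1 j) //= [R c0 j]mxE [R j j]mxE !eqxx jc (negbTE jc) /= mulr1 big1 ?addr0.
    rewrite LE0 LE; case: eqVneq => _; last by rewrite mul0r add0r.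
    by rewrite mul1r addNr.
  by move=> k /andP[kc kj]; rewrite [R k j]mxE (negbTE kc) (negbTE kj) mulr0.
exists L, R, q; split.
- apply: upper_unit => [i j ji|i]; rewrite mxE.
    case: (eqVneq j q) => [jq|_]; last by rewrite -val_eqE /= gtn_eqF.
    case: (eqVneq i q) => [iq|_]; first by rewrite jq iq ltnn in ji.
    by rewrite below -?jq // mul0r oppr0.
  by case: (eqVneq i q) => _; rewrite ?invr_eq0 ?eqxx ?oner_eq0.
- apply: upper_unit => [i j ji|i]; rewrite mxE.
    case: (eqVneq i c0) => [ic|_] /=; last by rewrite -val_eqE /= gtn_eqF.
    rewrite ic in ji *; rewrite -val_eqE /= (ltn_eqF ji) /=.
    by rewrite hq0 // mulr0 oppr0.
  by case: (eqVneq i c0) => _; rewrite ?eqxx ?oner_eq0.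
- split=> [i|j]; rewrite RE ?eqxx //.
  by case: eqVneq.
- move=> c cc; have c0F : (c == c0) = false by rewrite -val_eqE /= ltn_eqF.
  split=> [i|j]; rewrite RE.
    rewrite c0F hq0 // mulr0 subr0 (inv c cc).1.
    by case: (eqVneq i q) => [->|//]; rewrite qQ.
  rewrite Qc0 // mul0r mul0r subr0 (inv c cc).2 (eq_sym _ q) qQ //.
  by case: (eqVneq j c0) => [->|//]; rewrite eq_sym c0F.
Qed.

Lemma bruhat_decomposition g : g \in unitmx ->
  exists b1 b2 v, [/\ inB b1, inB b2 & b1 *m g *m b2 = pmat C v].
Proof.
move=> gU.
suff H p : (p <= n)%N -> exists b1 b2 Q, [/\ inB b1, inB b2 &
    forall c : 'I_n, (c < p)%N -> (forall i, (b1 *m g *m b2) i c = (i == Q c)%:R) /\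
      (forall j, (b1 *m g *m b2) (Q c) j = (j == c)%:R)].
  have [b1 [b2 [Q [B1 B2 HQ]]]] := H n (leqnn n).
  have Qinj : injective Q.
    move=> c d e; apply/eqP; have := (HQ c (ltn_ord c)).2 d.
    rewrite e (HQ d (ltn_ord d)).2 eqxx eq_sym.
    by case: eqVneq => // _ /eqP; rewrite oner_eq0.
  exists b1, b2, (perm Qinj); split=> //.
  by apply/matrixP => i j; rewrite pmatE permE (HQ j (ltn_ord j)).1.
elim: p => [_|p IH pn].
  by exists 1%:M, 1%:M, id; split=> //; exact: inB1.
have [b1 [b2 [Q [B1 B2 HQ]]]] := IH (ltnW pn).
have hU : b1 *m g *m b2 \in unitmx by rewrite !unitmx_mul gU (proj2 B1) (proj2 B2).
have [b1' [b2' [q [B1' B2' Hq HQ']]]] := bruhat_pivot (c0 := Ordinal pn) hU HQ.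
exists (b1' *m b1), (b2 *m b2'), (fun c => if c == Ordinal pn then q else Q c); split.
- exact: inB_mul.
- exact: inB_mul.
have -> : b1' *m b1 *m g *m (b2 *m b2') = b1' *m (b1 *m g *m b2) *m b2' by rewrite !mulmxA.
move=> c; rewrite ltnS leq_eqVlt => /orP[/eqP cp|cp].
  have -> : c = Ordinal pn by exact: val_inj.
  by rewrite eqxx.
have -> : (c == Ordinal pn) = false by rewrite -val_eqE /= ltn_eqF.
exact: HQ'.
Qed.

Lemma rk_bcell w g p q : bcell w g -> (rk g p q <= cnt w p q)%N.
Proof. by move=> [b1 [b2 [B1 B2 ->]]]; rewrite -(rk_pmat C); apply: rk_upper; [case: B1|case: B2]. Qed.

Lemma bcell_mul w g b1 b2 : inB b1 -> inB b2 -> bcell w g -> bcell w (b1 *m g *m b2).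
Proof.
move=> B1 B2 [c1 [c2 [C1 C2 ->]]]; exists (b1 *m c1), (c2 *m b2).
by split; [exact: inB_mul|exact: inB_mul|rewrite !mulmxA].
Qed.

Lemma bcell_unit w g : bcell w g -> g \in unitmx.
Proof. by move=> [b1 [b2 [[_ u1] [_ u2] ->]]]; rewrite !unitmx_mul u1 u2 pmat_unit. Qed.

(** A 2 x 2 identity in rows [v a], [v b] and columns [a], [b]: for t != 0, [1, 0; t, 1] =
    [-1/t, 1; 0, t] [0, 1; 1, 0] [1, 1/t; 0, 1]. *)
Lemma bcell_line v (a b : 'I_n) t : (a < b)%N -> (v a < v b)%N -> t != 0 ->
  bcell (tperm a b * v)%g (pmat C v + t *: delta_mx (v b) a).
Proof.
move=> ab vab t0.
have vne : (v a == v b) = false by rewrite -val_eqE /= ltn_eqF.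
have ne : (a == b) = false by rewrite -val_eqE /= ltn_eqF.
pose L : 'M[C]_n := \matrix_(i, j) (if j == v b then (i == v b)%:R * t + (i == v a)%:R
  else if j == v a then - ((i == v a)%:R * t^-1) else (i == j)%:R).
pose R : 'M[C]_n := \matrix_(i, j) ((i == j)%:R + ((i == a) && (j == b))%:R * t^-1).
exists L, R; split.
- apply: upper_unit => [i j ji|i]; rewrite mxE.
    case: (eqVneq j (v b)) => [jb|_].
      have -> : (i == v b) = false by rewrite -jb -val_eqE /= gtn_eqF.
      have -> : (i == v a) = false.
        by rewrite -val_eqE /= gtn_eqF // (ltn_trans vab) // -jb.
      by rewrite mul0r addr0.
    case: (eqVneq j (v a)) => [ja|_]; last by rewrite -val_eqE /= gtn_eqF.
    by rewrite -ja -val_eqE /= gtn_eqF // mul0r oppr0.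
  case: (eqVneq i (v b)) => [->|_].
    by rewrite mul1r (eq_sym (v b)) vne addr0.
  case: (eqVneq i (v a)) => _; last by rewrite eqxx oner_eq0.
  by rewrite mul1r oppr_eq0 invr_eq0.
- apply: upper_unit => [i j ji|i]; rewrite mxE.
    rewrite -val_eqE /= (gtn_eqF ji) add0r.
    case: eqVneq => [ia|_]; last by rewrite mul0r.
    case: eqVneq => [jb|_]; last by rewrite mul0r.
    by move: ab; rewrite -ia -jb ltnNge ltnW.
  rewrite eqxx; case: (eqVneq i a) => [->|_]; last by rewrite mul0r addr0 oner_eq0.
  by rewrite ne mul0r addr0 oner_eq0.
apply/matrixP => i j.
have X k : (L *m pmat C (tperm a b * v)%g) i k = L i (v (tperm a b k)).
  by rewrite mul_pmat permM.
have -> : (L *m pmat C (tperm a b * v)%g *m R) i j =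
    L i (v (tperm a b j)) + L i (v b) * (j == b)%:R * t^-1.
  rewrite mxE; under eq_bigr => k _ do rewrite X [R _ _]mxE mulrDr.
  rewrite big_split /= (bigD1 j) //= eqxx mulr1 big1 ?addr0; last first.
    by move=> k kj; rewrite (negbTE kj) mulr0.
  congr (_ + _); rewrite (bigD1 a) //= eqxx /= big1 ?addr0; last first.
    by move=> k ka; rewrite (negbTE ka) /= mul0r mulr0.
  by rewrite tpermL mulrA.
rewrite [LHS]mxE pmatE [X in _ + X = _]mxE [delta_mx _ _ _ _]mxE.
case: (eqVneq j a) => [->|ja].
  rewrite tpermL ne mulr0 mul0r addr0 mxE eqxx andbT.
  by rewrite addrC; congr (_ + _); rewrite mulrC.
rewrite andbF mulr0 addr0.
case: (eqVneq j b) => [->|jb].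
  rewrite tpermR mulr1 !mxE eqxx vne eqxx mulrDl mulfK // addrCA addNr addr0 //.
rewrite tpermD ?(eq_sym a) ?(eq_sym b) // mulr0 mul0r addr0 mxE.
by rewrite !(inj_eq perm_inj) (negbTE ja) (negbTE jb).
Qed.
End Bruhat.

(** * Bruhat order *)

Section BruhatOrder.
Variable n : nat.
Implicit Types (v w : 'S_n) (a b : 'I_n).

Lemma cntE w p q : cnt w p q = (\sum_(x : 'I_n) ((x < p) && (q <= w x)))%N.
Proof. by rewrite /cnt -sum1dep_card big_mkcond; apply: eq_bigr => x _; case: (_ && _). Qed.

Lemma cntS w (a : 'I_n) q : cnt w a.+1 q = (cnt w a q + (q <= w a))%N.
Proof.
rewrite !cntE [in LHS](bigD1 a) //= [in RHS](bigD1 a) //= ltnS leqnn ltnn /=.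
rewrite add0n addnC; congr (_ + _)%N; apply: eq_bigr => x xa.
by rewrite ltnS leq_eqVlt val_eqE (negbTE xa).
Qed.

Lemma cnt_mono w p p' q : (p <= p')%N -> (cnt w p q <= cnt w p' q)%N.
Proof.
move=> pp; apply/subset_leq_card/subsetP => x; rewrite !inE => /andP[xp ->].
by rewrite (leq_trans xp).
Qed.

Lemma cnt_tperm v a b p q : (a < b)%N -> (v a < v b)%N ->
  cnt (tperm a b * v)%g p q = (cnt v p q + [&& a < p, p <= b, v a < q & q <= v b])%N.
Proof.
move=> ab vab; have ba : b != a by rewrite -val_eqE /= gtn_eqF.
rewrite !cntE (bigD1 a) //= (bigD1 b) //= [in RHS](bigD1 a) //= [in RHS](bigD1 b) //=.
rewrite !permM tpermL tpermR.
under eq_bigr => x /andP[xa xb] do rewrite permM tpermD 1?eq_sym //.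
set s := bigop _ _ _; move: ab vab s; lia.
Qed.

(** Let [a] be the first position where [v] and [w] differ; equal counts before it force
    [v a < w a]. The value [w a] occurs in [v] after [a], so there is a least [b > a] with
    [v a < v b <= w a], and exchanging at [a], [b] stays below [w]. *)
Lemma bruhat_step v w : (forall p q, (cnt v p q <= cnt w p q)%N) -> v != w ->
  exists a b, [/\ (a < b)%N, (v a < v b)%N &
    forall p q, (cnt (tperm a b * v)%g p q <= cnt w p q)%N].
Proof.
move=> vw ne.
have [a0 ha0] : exists a, v a != w a.
  apply/existsP; apply/contraT; rewrite negb_exists => /forallP H.
  by case/negP: ne; apply/eqP/permP => x; apply/eqP; rewrite -[_ == _]negbK.
case: (arg_minnP (P := fun a => v a != w a) (fun a : 'I_n => nat_of_ord a) ha0) => a ha amin.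
have agree (x : 'I_n) : (x < a)%N -> v x = w x.
  by move=> xa; apply/eqP/contraT => /amin /=; rewrite leqNgt xa.
have cnta q : cnt v a q = cnt w a q.
  rewrite !cntE; apply: eq_bigr => x _; case xa: (x < a)%N => //=.
  by rewrite (agree x xa).
have va : (v a < w a)%N.
  have := vw a.+1 (v a); rewrite !cntS cnta leqnn leq_add2l.
  rewrite ltn_neqAle; have -> : (val (v a) != val (w a)) by rewrite val_eqE.
  by case: (v a <= w a)%N.
pose b0 := (v^-1%g (w a)).
have vb0 : v b0 = w a by rewrite permKV.
have Pb0 : [&& (a < b0)%N, (v a < v b0)%N & (v b0 <= w a)%N].
  rewrite vb0 va leqnn !andbT ltnNge leq_eqVlt; apply/negP => /orP[/eqP/val_inj e|lt].
    by move: ha; rewrite -vb0 e eqxx.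
  have /perm_inj e : w b0 = w a by rewrite -(agree _ lt).
  by rewrite e ltnn in lt.
case: (arg_minnP (P := fun b => [&& (a < b)%N, (v a < v b)%N & (v b <= w a)%N])
  (fun b : 'I_n => nat_of_ord b) Pb0) => b /and3P[ab vab vbw] bmin.
exists a, b; split=> // p q; rewrite cnt_tperm //.
case: (boolP [&& _, _, _ & _]) => [/and4P[ap pb vaq qvb]|_]; last by rewrite addn0.
(* Values in [q, w a] at positions below [p]: before [a] both permutations agree, at [a] only [w]
   takes one, and after [a] minimality of [b] bars [v] from them. So [w] has at least one more, and
   the bound at [(w a).+1] yields the required slack. *)
have key : (cnt v p q + cnt w p (w a).+1 + 1 <= cnt v p (w a).+1 + cnt w p q)%N.
  have -> : 1%N = (\sum_(x : 'I_n) (x == a))%N.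
    by rewrite (bigD1 a) //= eqxx big1 // => x /negbTE ->.
  rewrite !cntE -!big_split /=; apply: leq_sum => x _.
  case: (ltngtP x a) => xa.
  - by rewrite (agree x xa) -val_eqE /= (ltn_eqF xa) addn0 addnC.
  - have : ~~ [&& (x < p)%N, (v a < v x)%N & (v x <= w a)%N].
      apply/negP => /and3P[xp vax vxa]; have := bmin x.
      by rewrite xa vax vxa /= => /(_ isT); rewrite leqNgt (leq_trans xp pb).
    rewrite -val_eqE /= (gtn_eqF xa); move: vaq qvb vbw; lia.
  - have -> : x = a by exact: val_inj.
    by rewrite eqxx; move: vaq qvb vbw ap; lia.
have := vw p (w a).+1; move: key; rewrite addn1; lia.
Qed.

Lemma bruhat_chain (P : 'S_n -> Prop) w : P w ->
  (forall v a b, (a < b)%N -> (v a < v b)%N -> P (tperm a b * v)%g -> P v) ->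
  forall v, (forall p q, (cnt v p q <= cnt w p q)%N) -> P v.
Proof.
move=> Pw step v.
(* The total of all counts grows at each exchange, strictly at [p = b], [q = v b], and is bounded by
   [mu w]; hence the climb ends. *)
pose mu (u : 'S_n) := (\sum_(p < n.+1) \sum_(q < n.+1) cnt u p q)%N.
have [k] := ubnP (mu w - mu v)%N; elim: k v => // k IH v lek vw.
have [->//|ne] := eqVneq v w.
have [a [b [ab vab H]]] := bruhat_step vw ne.
apply: (step v a b ab vab); apply: IH => //.
have mule u : (forall p q, (cnt u p q <= cnt w p q)%N) -> (mu u <= mu w)%N.
  by move=> uw; apply: leq_sum => p _; apply: leq_sum => q _.
suff : (mu v < mu (tperm a b * v)%g)%N by have := mule _ H; have := mule _ vw; lia.
have bn : (b < n.+1)%N by rewrite ltnS ltnW.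
have vbn : (v b < n.+1)%N by rewrite ltnS ltnW.
rewrite /mu (bigD1 (Ordinal bn)) //= [ltnRHS](bigD1 (Ordinal bn)) //= -addSn.
apply: leq_add; last first.
  by apply: leq_sum => p _; apply: leq_sum => q _; rewrite cnt_tperm // leq_addr.
rewrite (bigD1 (Ordinal vbn)) //= [leqRHS](bigD1 (Ordinal vbn)) //= -addSn.
apply: leq_add; last by apply: leq_sum => q _; rewrite cnt_tperm // leq_addr.
by rewrite cnt_tperm // ab vab !leqnn addn1.
Qed.
End BruhatOrder.

(** * Schubert varieties as rank loci *)

Section SchubertClosure.
Variables (C : numFieldType) (n : nat).
Implicit Types (g h b : 'M[C]_n) (v w : 'S_n).

Lemma zclosure_rk (S : 'M[C]_n -> Prop) g p q r :
  (forall h, S h -> (rk h p q <= r)%N) -> zclosure S g -> (rk g p q <= r)%N.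
Proof.
move=> Sr Sg; rewrite -ltnS; apply/rank_lt_det => X Y.
apply: (zclosure_regular (F := fun h => \det (X *m (copid_mx q *m h *m pid_mx p) *m Y)) Sg).
  apply: regular_det => i j.
  apply: regular_ext (regular_mul (X *m copid_mx q) (pid_mx p *m Y) i j) => h.
  by rewrite !mulmxA.
by move=> h /Sr; rewrite -ltnS => /rank_lt_det.
Qed.

Lemma bcell_zclosure w g : g \in unitmx ->
  zclosure (bcell w) g <-> forall p q, (rk g p q <= cnt w p q)%N.
Proof.
move=> gU; split=> [Zg p q|rkg].
  by apply: zclosure_rk Zg => h; exact: rk_bcell.
have [b1 [b2 [v [B1 B2 e]]]] := bruhat_decomposition gU.
have cell v' b b' : inB b -> inB b' -> zclosure (bcell w) (pmat C v') ->
    zclosure (bcell w) (b *m pmat C v' *m b').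
  by move=> ib ib'; apply: zclosure_mul => h; exact: bcell_mul.
have -> : g = invmx b1 *m pmat C v *m invmx b2.
  by rewrite -e !mulmxA mulVmx ?mul1mx ?mulmxK //; [case: B2 | case: B1].
apply: (cell); try exact: inB_inv.
apply: (bruhat_chain (P := fun v => zclosure (bcell w) (pmat C v))) => [|v' a b ab vab Z|p q].
- apply: sub_zclosure; exists 1%:M, 1%:M.
  by split; [exact: inB1|exact: inB1|rewrite mulmx1 mul1mx].
- apply: (@zclosure_trans _ _ (bcell (tperm a b * v')%g)).
    by move=> h [c1 [c2 [C1 C2 ->]]]; exact: cell.
  by apply: (zclosure_line (X := delta_mx (v' b) a)) => t t0; exact: bcell_line.
- rewrite -(rk_pmat C) -e; apply: leq_trans (rkg p q); apply: rk_upper; [by case: B1 | by case: B2].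
Qed.

(** An element of B with prescribed determinant: multiplying by it on the right normalises a matrix
    without changing its flag. *)
Definition rescale_col0 (t : C) : 'M[C]_n := diag_mx (\row_j (if j == 0%N :> nat then t else 1)).

Lemma inB_rescale t : t != 0 -> inB (rescale_col0 t).
Proof.
move=> t0; apply: upper_unit => [i j ji|i]; rewrite !mxE.
  by rewrite -val_eqE /= (gtn_eqF ji) mulr0n.
by rewrite eqxx mulr1n; case: ifP; rewrite ?oner_eq0.
Qed.

Lemma det_rescale t : (0 < n)%N -> \det (rescale_col0 t) = t.
Proof.
move=> n0; rewrite det_diag (bigD1 (Ordinal n0)) //= mxE eqxx big1 ?mulr1 // => i.
by rewrite -val_eqE /= => /negbTE i0; rewrite mxE i0.
Qed.

(** For a right B-stable set, passing to its matrices of determinant 1 loses no closure point of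
    determinant 1. *)
Lemma zclosure_SL (S : 'M[C]_n -> Prop) g : (0 < n)%N ->
  (forall h, S h -> h \in unitmx) -> (forall h b, S h -> inB b -> S (h *m b)) ->
  \det g = 1 -> zclosure S g -> zclosure (fun h => inSL h /\ S h) g.
Proof.
move=> n0 Su SB dg; apply: (zclosure_normalize (D := rescale_col0)) => // [h Sh||i j].
- have := Su h Sh; rewrite unitmxE unitfE => dh; split.
    by rewrite /inSL det_mulmx det_rescale // mulfV.
  by apply: SB => //; apply: inB_rescale; rewrite invr_eq0.
- apply/matrixP => i j; rewrite !mxE.
  by rewrite if_same.
- case: (eqVneq i j) => [->|ne]; last first.
    by exists 0, 0 => t; rewrite !mxE (negbTE ne) mulr0 addr0.
  case: (eqVneq (j : nat) 0%N) => [j0|/negbTE j0].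
    by exists 0, 1 => t; rewrite !mxE j0 !eqxx mulr1 add0r.
  by exists 1, 0 => t; rewrite !mxE j0 eqxx mulr0 addr0.
Qed.

Lemma XupP w g : (0 < n)%N -> \det g = 1 ->
  Xup w g <-> forall p q, (rk g p q <= cnt w p q)%N.
Proof.
move=> n0 dg; have gU : g \in unitmx by rewrite unitmxE dg unitr1.
rewrite -bcell_zclosure //; split=> [[_]|Zg].
  by apply: zclosure_trans => h [_ [b1 [b2 H]]]; apply: sub_zclosure; exists b1, b2.
split=> //; have SB h b : bcell w h -> inB b -> bcell w (h *m b).
  move=> [b1 [b2 [B1 B2 ->]]] ib; exists b1, (b2 *m b).
  by split=> //; [exact: inB_mul | rewrite mulmxA].
exact: zclosure_SL n0 (@bcell_unit _ _ w) SB dg Zg.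
Qed.

(** The explicit form of the longest element; [w0], given by maximality, is identified with it in
    [w0E]. *)
Definition revp : 'S_n := perm (@rev_ord_inj n).

Lemma pmat_revE m (A : 'M[C]_(n, m)) i j : (pmat C revp *m A) i j = A (rev_ord i) j.
Proof.
rewrite mxE (bigD1 (rev_ord i)) //= pmatE permE rev_ordK eqxx mul1r big1 ?addr0 // => k.
move=> ne; rewrite pmatE permE eq_sym (can2_eq (@rev_ordK n) (@rev_ordK n)).
by rewrite (negbTE ne) mul0r.
Qed.

Lemma mul_pmat_revE m (A : 'M[C]_(m, n)) i j : (A *m pmat C revp) i j = A i (rev_ord j).
Proof. by rewrite mul_pmat permE. Qed.

Lemma pmat_rev_inv : invmx (pmat C revp) = pmat C revp.
Proof.
have e : pmat C revp *m pmat C revp = 1%:M.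
  by apply/matrixP => i j; rewrite pmat_revE pmatE permE !mxE (inj_eq (@rev_ord_inj n)).
by rewrite -[LHS]mulmx1 -e mulKmx // pmat_unit.
Qed.

Lemma rev_lower b : inB b -> inBm (pmat C revp *m b *m pmat C revp).
Proof.
move=> [ub bU]; split; last by rewrite !unitmx_mul bU pmat_unit.
move=> i j ij; rewrite mul_pmat_revE pmat_revE; apply: ub => /=.
by have := ltn_ord j; lia.
Qed.

Lemma rev_upper b : inBm b -> inB (pmat C revp *m b *m pmat C revp).
Proof.
move=> [ub bU]; split; last by rewrite !unitmx_mul bU pmat_unit.
move=> i j ij; rewrite mul_pmat_revE pmat_revE; apply: ub => /=.
by have := ltn_ord i; lia.
Qed.

Definition cntl v p m : nat := #|[set a : 'I_n | (a < p)%N && (v a < m)%N]|.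

Lemma rk_rev g p m : (m <= n)%N ->
  rk (pmat C revp *m g) p (n - m) = \rank ((pid_mx m : 'M[C]_n) *m g *m (pid_mx p : 'M[C]_n)).
Proof.
move=> mn; have fu : row_free (pmat C revp)^T by rewrite row_free_unit unitmx_tr pmat_unit.
rewrite /rk -[RHS]mxrank_tr -[RHS](mxrankMfree _ fu) -trmx_mul mxrank_tr; congr mxrank.
apply/matrixP => i j; rewrite cornerE pmat_revE.
rewrite [RHS]pmat_revE pid_diagE mul_diag_mx (pid_diagE _ _ p) mul_mx_diag !mxE /=.
have -> : (n - m <= i)%N = (n - i.+1 < m)%N by have := ltn_ord i; lia.
by do 2 case: (_ < _)%N; rewrite ?mul1r ?mul0r ?mulr1 ?mulr0.
Qed.

Lemma cnt_rev v p m : (m <= n)%N -> cnt (v * revp)%g p (n - m) = cntl v p m.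
Proof.
move=> mn; apply: eq_card => x; rewrite !inE permM permE /=; congr (_ && _).
by have := ltn_ord (v x); lia.
Qed.

Lemma XlowP v g : (0 < n)%N -> \det g = 1 ->
  Xlow v g <-> forall p m, (p <= n)%N -> (m <= n)%N ->
    (\rank ((pid_mx m : 'M[C]_n) *m g *m (pid_mx p : 'M[C]_n)) <= cntl v p m)%N.
Proof.
move=> n0 dg; have gU : g \in unitmx by rewrite unitmxE dg unitr1.
pose S h := exists bm b, [/\ inBm bm, inB b & h = bm *m pmat C v *m b].
have NU : pmat C revp \in unitmx := pmat_unit C revp.
have NgU : pmat C revp *m g \in unitmx by rewrite unitmx_mul NU.
have NN m (A : 'M[C]_(n, m)) : pmat C revp *m (pmat C revp *m A) = A.
  by rewrite -{1}pmat_rev_inv mulKmx.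
split=> [[_ Zg] p m _ mn|H].
  rewrite -rk_rev // -cnt_rev //; move: p (n - m)%N; apply/bcell_zclosure => //.
  rewrite -[_ *m g]mulmx1; apply: zclosure_mul Zg => h [_ [bm [b [Bm B ->]]]].
  exists (pmat C revp *m bm *m pmat C revp), b; split=> //; first exact: rev_upper.
  by rewrite pmatM mulmx1 -!mulmxA NN.
split=> //.
have ZS : zclosure S g.
  have : zclosure (bcell (v * revp)%g) (pmat C revp *m g).
    apply/bcell_zclosure => // p q.
    have -> : rk (pmat C revp *m g) p q = rk (pmat C revp *m g) (minn n p) q.
      by rewrite /rk pid_mx_minv.
    have -> : cnt (v * revp)%g p q = cnt (v * revp)%g (minn n p) q.
      by apply: eq_card => x; rewrite !inE leq_min ltn_ord.
    have := geq_minl n p; move: (minn n p) => {}p pn.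
    have [qn|qn] := leqP q n; last first.
      suff -> : rk (pmat C revp *m g) p q = 0%N by [].
      apply/eqP; rewrite mxrank_eq0; apply/eqP/matrixP => i j; rewrite cornerE.
      by rewrite leqNgt (ltn_trans (ltn_ord i) qn) [RHS]mxE.
    by rewrite -(subKn qn) rk_rev ?leq_subr // cnt_rev ?leq_subr // H ?leq_subr.
  rewrite -{2}(NN _ g) -[in X in _ -> X](mulmx1 (_ *m (_ *m g))).
  apply: zclosure_mul => h [b1 [b2 [B1 B2 ->]]].
  exists (pmat C revp *m b1 *m pmat C revp), b2; split=> //; first exact: rev_lower.
  by rewrite pmatM mulmx1 !mulmxA.
have Su h : S h -> h \in unitmx.
  by move=> [bm [b [[_ u1] [_ u2] ->]]]; rewrite !unitmx_mul u1 u2 pmat_unit.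
have SB h b : S h -> inB b -> S (h *m b).
  move=> [bm [b' [Bm B' ->]]] ib; exists bm, (b' *m b).
  by split=> //; [exact: inB_mul | rewrite mulmxA].
exact: zclosure_SL n0 Su SB dg ZS.
Qed.
End SchubertClosure.

(** * Flags *)

Section Flags.
Variables (C : fieldType) (n : nat).
Implicit Types (g h b : 'M[C]_n) (v w : 'S_n).

Lemma toprows_pid p q m (A : 'M[C]_(p, q)) : toprows m A = pid_mx m *m A.
Proof.
apply/matrixP => a b; rewrite !mxE /mget (insubT (fun k => (k < q)%N) (ltn_ord b)).
case: (insubP 'I_p a) => [i _ ia|].
  rewrite (bigD1 i) //= big1 => [|k ki]; last first.
    by rewrite mxE -ia val_eqE eq_sym (negbTE ki) mul0r.
  by rewrite !mxE ia eqxx ltn_ord mul1r addr0; congr (A _ _); exact: val_inj.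
rewrite -leqNgt => pa; rewrite big1 // => k _; rewrite mxE.
by rewrite gtn_eqF ?mul0r // (leq_trans (ltn_ord k)).
Qed.

Lemma toprows_eqmx m h : (toprows m h :=: (pid_mx m : 'M[C]_n) *m h)%MS.
Proof.
rewrite toprows_pid; apply/eqmxP/andP; split.
  have -> : pid_mx m = pid_mx m *m (pid_mx m : 'M[C]_n) :> 'M[C]_(m, n).
    by rewrite mul_pid_mx minnn pid_mx_minh.
  by rewrite -mulmxA submxMl.
have -> : (pid_mx m : 'M[C]_n) = (pid_mx m : 'M[C]_(n, m)) *m pid_mx m.
  by rewrite mul_pid_mx !minnn.
by rewrite -mulmxA submxMl.
Qed.

(** [X] need only preserve the span of the first [p] basis vectors. It will be an element of B, or
    such an element times a permutation of columns inside blocks. *)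
Lemma toprows_stable p g X : X \in unitmx -> copid_mx p *m X *m pid_mx p = 0 :> 'M[C]_n ->
  (toprows p (g *m X)^T == toprows p g^T)%MS.
Proof.
move=> XU; rewrite /copid_mx mulmxBl mul1mx mulmxBl => /eqP; rewrite subr_eq0 => /eqP Xp.
apply/eqmxP.
apply: eqmx_trans (toprows_eqmx _ _) (eqmx_trans _ (eqmx_sym (toprows_eqmx _ _))).
rewrite trmx_mul mulmxA; apply/eqmxMr/eqmxP/stable_eqmx; first by rewrite unitmx_tr.
by move/(congr1 trmx): Xp; rewrite !trmx_mul !tr_pid_mx => ->; rewrite mulmxA submxMl.
Qed.

Lemma rkE g p q : rk g p q = \rank (toprows p g^T *m copid_mx q).
Proof.
rewrite (eqmxMr _ (toprows_eqmx p g^T)) /rk -mxrank_tr !trmx_mul tr_pid_mx.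
by rewrite /copid_mx linearB /= trmx1 tr_pid_mx mulmxA.
Qed.

Lemma rank_pid_pid g p m :
  \rank ((pid_mx m : 'M[C]_n) *m g *m (pid_mx p : 'M[C]_n)) =
  \rank (toprows p g^T *m (pid_mx m : 'M[C]_n)).
Proof.
by rewrite (eqmxMr _ (toprows_eqmx p g^T)) -mxrank_tr !trmx_mul !tr_pid_mx mulmxA.
Qed.

Lemma rank_adds_row m (A : 'M[C]_(m, n)) (x : 'rV[C]_n) :
  ~~ (x <= A)%MS -> \rank (A + x)%MS = (\rank A).+1.
Proof.
move=> xA; apply/eqP; rewrite eqn_leq; apply/andP; split.
  apply: leq_trans (mxrank_adds_leqif A x) _.
  by rewrite -(addn1 (\rank A)) leq_add2l; exact: rank_leq_row.
rewrite ltnNge (geq_leqif (mxrank_leqif_sup (addsmxSl A x))).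
by apply: contra xA; apply: submx_trans; exact: addsmxSr.
Qed.

Lemma exists_row_notin m1 m2 (A : 'M[C]_(m1, n)) (B : 'M[C]_(m2, n)) :
  (\rank A < \rank B)%N -> exists x : 'rV[C]_n, (x <= B)%MS /\ ~~ (x <= A)%MS.
Proof.
move=> rAB; have /row_subPn[i Hi] : ~~ (B <= A)%MS.
  by apply/negP => /mxrankS; rewrite leqNgt rAB.
by exists (row i B); split=> //; exact: row_sub.
Qed.

Lemma subspace_between m1 m2 (A : 'M[C]_(m1, n)) (B : 'M[C]_(m2, n)) d :
  (A <= B)%MS -> (\rank A <= d <= \rank B)%N ->
  exists F : 'M[C]_n, [/\ (A <= F)%MS, (F <= B)%MS & \rank F = d].
Proof.
move=> sAB /andP[]; elim: d => [|d IH].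
  rewrite leqn0 mxrank_eq0 => /eqP -> _; exists 0.
  by rewrite !sub0mx mxrank0.
rewrite leq_eqVlt => /orP[/eqP <- _|].
  by exists <<A>>%MS; rewrite !genmxE.
rewrite ltnS => rAd dB; have [F [AF FB rF]] := IH rAd (ltnW dB).
have [x [xB xF]] : exists x : 'rV[C]_n, (x <= B)%MS /\ ~~ (x <= F)%MS.
  by apply: exists_row_notin; rewrite rF.
exists (F + x)%MS; split; first by rewrite (submx_trans AF) // addsmxSl.
  by rewrite addsmx_sub FB.
by rewrite rank_adds_row // rF.
Qed.

Lemma flag_completion (ms : pred nat) (V : nat -> 'M[C]_n) :
  (forall m, ms m -> (m <= n)%N -> \rank (V m) = m) ->
  (forall m m', ms m -> ms m' -> (m <= m' <= n)%N -> (V m <= V m')%MS) ->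
  exists2 h, h \in unitmx &
    forall m, ms m -> (m <= n)%N -> ((pid_mx m : 'M[C]_n) *m h == V m)%MS.
Proof.
move=> rV sV.
suff H p : (p <= n)%N -> exists h,
    [/\ \rank ((pid_mx p : 'M[C]_n) *m h) = p,
      forall m, ms m -> (m <= p)%N -> ((pid_mx m : 'M[C]_n) *m h == V m)%MS &
      forall m, ms m -> (p <= m <= n)%N -> ((pid_mx p : 'M[C]_n) *m h <= V m)%MS].
  have [h [rh Hh _]] := H n (leqnn n); exists h => //.
  by rewrite -row_free_unit -row_leq_rank -[X in (X <= _)%N]rh pid_mx_1 mul1mx.
elim: p => [_|p IH pn].
  exists 0; split=> [|m msm|m msm _]; rewrite ?mulmx0 ?mxrank0 ?sub0mx //.
  rewrite leqn0 => /eqP m0; rewrite m0 in msm *.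
  by rewrite (eqP (_ : V 0%N == 0)) ?sub0mx // -mxrank_eq0 rV.
have [h [rh Hh Hh']] := IH (ltnW pn).
(* [W] is the smallest prescribed space of dimension above [p], or the whole space if there is none.
   Taking the next row in [W] keeps the partial flag inside every later prescribed member. *)
have [W [rW hW WV]] : exists W : 'M[C]_n, [/\ (p < \rank W)%N,
    ((pid_mx p : 'M[C]_n) *m h <= W)%MS &
    forall m, ms m -> (p < m <= n)%N -> (W <= V m)%MS].
  pose Q m := ms m && (p < m <= n)%N.
  case: (boolP [exists m : 'I_n.+1, Q m]) => [/existsP[m0 Qm0]|no].
    have exQ : exists m, Q m by exists m0.
    case: (ex_minnP exQ) => m /andP[msm /andP[pm mn]] mmin.
    exists (V m); split; first by rewrite rV.
      by apply: Hh' => //; rewrite (ltnW pm).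
    move=> m' msm' pm'; apply: sV => //; rewrite (andP pm').2 andbT; apply: mmin.
    by rewrite /Q msm'.
  exists 1%:M; split; rewrite ?mxrank1 ?submx1 // => m msm pmn.
  case/negP: no; apply/existsP; exists (inord m).
  by rewrite /Q inordK ?msm // ltnS; case/andP: pmn.
have [x [xW xh]] : exists x : 'rV[C]_n, (x <= W)%MS /\ ~~ (x <= (pid_mx p : 'M[C]_n) *m h)%MS.
  by apply: exists_row_notin; rewrite rh.
pose h' : 'M[C]_n := \matrix_(i, j) if i == p :> nat then x 0 j else h i j.
have pidE m i j (A : 'M[C]_n) : ((pid_mx m : 'M[C]_n) *m A) i j = if (i < m)%N then A i j else 0.
  by rewrite pid_diagE mul_diag_mx !mxE; case: ifP; rewrite ?mul1r ?mul0r.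
have eq_low m : (m <= p)%N -> (pid_mx m : 'M[C]_n) *m h' = pid_mx m *m h.
  move=> mp; apply/matrixP => i j; rewrite !pidE; case: ifP => // im.
  by rewrite mxE ltn_eqF // (leq_trans im).
have eqS : ((pid_mx p.+1 : 'M[C]_n) *m h' :=: (pid_mx p : 'M[C]_n) *m h + x)%MS.
  apply/eqmxP/andP; split.
    apply/row_subP => i; case: (ltngtP i p) => ip.
    - have -> : row i (pid_mx p.+1 *m h') = row i ((pid_mx p : 'M[C]_n) *m h).
        apply/rowP => j; rewrite !mxE -[LHS]/(\sum_j0 _) .
        by have := pidE p.+1 i j h'; have := pidE p i j h; rewrite !mxE => -> ->; rewrite ip ltnS ltnW // ltn_eqF.
      by apply: submx_trans (row_sub _ _) (addsmxSl _ _).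
    - have -> : row i (pid_mx p.+1 *m h') = 0.
        by apply/rowP => j; rewrite [LHS]mxE pidE ltnS leqNgt ip [RHS]mxE.
      exact: sub0mx.
    - have -> : row i (pid_mx p.+1 *m h') = x.
        by apply/rowP => j; rewrite [LHS]mxE pidE ip ltnS leqnn mxE ip eqxx.
      exact: addsmxSr.
  rewrite addsmx_sub; apply/andP; split.
    rewrite -(eq_low p) //.
    have -> : (pid_mx p : 'M[C]_n) = (pid_mx p : 'M[C]_n) *m (pid_mx p.+1 : 'M[C]_n).
      by rewrite mul_pid_mx pid_mx_minv; congr pid_mx; lia.
    by rewrite -mulmxA submxMl.
  have -> : x = row (Ordinal pn) ((pid_mx p.+1 : 'M[C]_n) *m h').
    by apply/rowP => j; rewrite [RHS]mxE pidE /= ltnS leqnn mxE /= eqxx.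
  exact: row_sub.
have rS : \rank ((pid_mx p.+1 : 'M[C]_n) *m h') = p.+1 by rewrite eqS rank_adds_row // rh.
have subS m : ms m -> (p < m <= n)%N -> ((pid_mx p.+1 : 'M[C]_n) *m h' <= V m)%MS.
  move=> msm pm; rewrite eqS addsmx_sub (submx_trans hW) ?WV //=.
  by rewrite (submx_trans xW) ?WV.
exists h'; split=> // m msm; rewrite leq_eqVlt => /orP[/eqP mp|]; last first.
  by rewrite ltnS => mp; rewrite eq_low //; exact: Hh.
rewrite mp in msm *; have s := subS _ msm (introT andP (conj (leqnn _) pn)).
by rewrite -(geq_leqif (mxrank_leqif_eq s)) rS rV.
Qed.
End Flags.

(** * Inversions and minimal coset representatives *)

Section Inversions.
Variable n : nat.
Implicit Types (u v w : 'S_n) (a b x y : 'I_n).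

Lemma tperm_adj_lt a b (m : nat) x : b = a.+1 :> nat -> m != b ->
  (tperm a b x < m)%N = (x < m)%N.
Proof.
move=> ba mb; case: tpermP => [->|->|//]; lia.
Qed.

(** Applying the adjacent transposition to both positions injects the old inversions into the new
    ones: it reverses the order of the pair [(a, b)] only, which is not an old inversion. That pair
    itself becomes a new one. *)
Lemma ninv_tperm w a b : b = a.+1 :> nat -> (w a < w b)%N ->
  (ninv w < ninv (tperm a b * w)%g)%N.
Proof.
move=> ba wab; rewrite /ninv.
set I := [set p | _ & _]; set J := [set p | _ & _].
pose f (p : 'I_n * 'I_n) := (tperm a b p.1, tperm a b p.2).
have finj : injective f by move=> [x y] [x' y'] [/perm_inj -> /perm_inj ->].
rewrite -(card_imset (mem I) finj); apply: proper_card; apply/properP; split.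
  apply/subsetP => z /imsetP[[x y]]; rewrite inE /= => /andP[xy wyx] ->.
  rewrite inE /= !permM !tpermK wyx andbT.
  case: (tpermP a b x) => [ex|ex|/eqP xa /eqP xb];
    case: (tpermP a b y) => [ey|ey|/eqP ya /eqP yb]; move: xy wyx; rewrite ?ex ?ey ?ltnn //.
  - by move=> _; rewrite ltnNge ltnW.
  - by move: ya yb; rewrite -!val_eqE /=; lia.
  - by rewrite ba; lia.
  - by move: ya yb; rewrite -!val_eqE /=; lia.
  - by move: xa xb; rewrite -!val_eqE /=; lia.
  - by move: xa xb; rewrite -!val_eqE /=; lia.
exists (a, b); first by rewrite inE /= !permM tpermL tpermR wab ba leqnn.
apply/imsetP => -[[x y]]; rewrite inE /= => /andP[xy _] [ea eb].
have ex : x = b by apply: (@perm_inj _ (tperm a b)); rewrite -ea tpermR.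
have ey : y = a by apply: (@perm_inj _ (tperm a b)); rewrite -eb tpermL.
by move: xy; rewrite ex ey ba ltnNge leqnSn.
Qed.

Lemma simp_tperm k : (0 < k < n)%N ->
  exists a b : 'I_n, [/\ a = k.-1 :> nat, b = k :> nat & simp n k = tperm a b].
Proof.
move=> /andP[k0 kn]; have k1 : (k.-1 < n)%N by lia.
exists (Ordinal k1), (Ordinal kn); split=> //.
by rewrite /simp !insubT /= k0; congr tperm; exact: val_inj.
Qed.

(** A strictly decreasing map of an interval to itself is squeezed: [up] descends from the left end,
    [down] climbs from the right end, and the two bounds meet. *)
Lemma perm_decr_block w (lo hi : nat) :
  (forall x, (lo <= x < hi)%N -> (lo <= w x < hi)%N) -> (hi <= n)%N ->
  (forall x y, y = x.+1 :> nat -> (lo <= x)%N -> (y < hi)%N -> (w y < w x)%N) ->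
  forall x, (lo <= x < hi)%N -> (w x + x).+1 = (lo + hi)%N.
Proof.
move=> wst hin wdec.
have up k x : x = (lo + k)%N :> nat -> (x < hi)%N -> (w x + k < hi)%N.
  elim: k x => [|k IH] x xk xh.
    by have := wst x; lia.
  have kn : (lo + k < n)%N by have := ltn_ord x; lia.
  have := wdec (Ordinal kn) x; have := IH (Ordinal kn) (erefl _); rewrite /=.
  lia.
have down k x : (x + k).+1 = hi -> (lo <= x)%N -> (lo + k <= w x)%N.
  elim: k x => [|k IH] x xk xl.
    by have := wst x; lia.
  have kn : (x.+1 < n)%N by lia.
  have := IH (Ordinal kn); have := wdec x (Ordinal kn); rewrite /=.
  lia.
move=> x /andP[lx xh].
have := up (x - lo)%N x; have := down (hi - x.+1)%N x; lia.
Qed.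

(** A permutation with the most inversions has no adjacent ascent, since exchanging there would
    create one more; so it is decreasing. *)
Lemma w0_rev x : (w0 n x + x).+1 = n.
Proof.
rewrite -[RHS]add0n; apply: perm_decr_block; rewrite ?leq0n ?ltn_ord //= => a b ba _ _.
rewrite /w0; case: arg_maxnP => // w _ wmax.
rewrite ltnNge leq_eqVlt; apply/negP => /orP[/eqP/val_inj/perm_inj e|wab].
  by move: ba; rewrite e; lia.
by have := wmax (tperm a b * w)%g isT; rewrite /= leqNgt ninv_tperm.
Qed.

(** The permutations preserving an initial segment form a group, so only the generators need
    checking. *)
Lemma wP_stable (ns : seq nat) (m : nat) x : m \in ns -> (wP n ns x < m)%N = (x < m)%N.
Proof.
move=> mns.
pose H := [set u : 'S_n | [forall y : 'I_n, (u y < m)%N == (y < m)%N]].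
have gH : group_set H.
  apply/group_setP; split; first by rewrite inE; apply/forallP => y; rewrite perm1.
  move=> u v; rewrite !inE => /forallP Hu /forallP Hv; apply/forallP => y.
  by rewrite permM (eqP (Hv _)) (eqP (Hu _)).
have sub : WP n ns \subset Group gH.
  rewrite gen_subG; apply/subsetP => z /imsetP[k]; rewrite inE => /andP[k0 kns] ->.
  have [|a [b [ea eb ->]]] := @simp_tperm k; first by rewrite k0 ltn_ord.
  rewrite inE; apply/forallP => y; rewrite tperm_adj_lt //; first by rewrite ea eb prednK.
  by apply: contraNneq kns => mb; rewrite /= -eb -mb.
rewrite /wP; case: arg_maxnP => [|w wW _]; first exact: group1.
by have := subsetP sub _ wW; rewrite inE => /forallP/(_ x)/eqP.
Qed.

Lemma wP_descent (ns : seq nat) a b : b = a.+1 :> nat -> val b \notin ns ->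
  (wP n ns b < wP n ns a)%N.
Proof.
move=> ba bns; rewrite /wP; case: arg_maxnP => [|w wW wmax]; first exact: group1.
rewrite ltnNge leq_eqVlt; apply/negP => /orP[/eqP/val_inj/perm_inj e|wab].
  by move: ba; rewrite e; lia.
(* Positions count from 0 and simple transpositions from 1, so the exchange of [a] and [b = a + 1]
   is the generator of index [b]. *)
have tW : tperm a b \in WP n ns.
  apply: mem_gen; apply/imsetP; exists b; first by rewrite inE bns ba.
  have [|a' [b' [ea eb ->]]] := @simp_tperm b; first by rewrite ltn_ord ba.
  by congr tperm; apply: val_inj; rewrite /= ?ea ?eb ?ba.
have := wmax (tperm a b * w)%g (groupM tW wW).
by rewrite /= leqNgt ninv_tperm.
Qed.

Lemma cnt_full w p q : (n <= p)%N -> cnt w p q = #|[set y : 'I_n | (q <= y)%N]|.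
Proof.
move=> np; rewrite -(card_preimset _ (@perm_inj _ w)); apply: eq_card => x.
by rewrite !inE (leq_trans (ltn_ord x) np).
Qed.

(** Inside a block [v] increases, so its count for a fixed [q] is first constant and then grows by
    one at each position. On the constant part compare with the left end of the block, where the
    count of [w] is no larger ([D]); on the growing part with the right end, since the count of [w]
    grows by at most one per position ([U]). *)
Lemma cnt_le_blocks (ms : pred nat) v w :
  (forall a b, b = a.+1 :> nat -> ~~ ms b -> (v a < v b)%N) ->
  (forall p q, ms p -> (p <= n)%N -> (cnt v p q <= cnt w p q)%N) ->
  forall p q, (cnt v p q <= cnt w p q)%N.
Proof.
move=> asc vw p q.
have cnt0 u : cnt u 0 q = 0%N by apply: eq_card0 => x; rewrite !inE.
have D a : (v a < q)%N -> (cnt v a.+1 q <= cnt w a.+1 q)%N.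
  have [k] := ubnP (a : nat); elim: k a => // k IH a; rewrite ltnS => ak va.
  rewrite [cnt v _ _]cntS (leqNgt q (v a)) va addn0; apply: leq_trans (cnt_mono _ _ (leqnSn a)).
  have [a0|a0] := posnP (a : nat); first by rewrite a0 cnt0.
  case: (boolP (ms a)) => [msa|msa]; first by apply: vw => //; exact: ltnW.
  have a1n : (a.-1 < n)%N by have := ltn_ord a; lia.
  have := IH (Ordinal a1n); rewrite /= prednK //; apply; first by lia.
  by apply: ltn_trans va; apply: asc => //=; rewrite prednK.
have U a : (q <= v a)%N -> (cnt v a q <= cnt w a q)%N.
  have [k] := ubnP (n - a)%N; elim: k a => // k IH a; rewrite ltnS => ak va.
  suff : (cnt v a.+1 q <= cnt w a.+1 q)%N by rewrite !cntS va; lia.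
  have [an|an] := leqP n a.+1; first by rewrite !cnt_full.
  case: (boolP (ms a.+1)) => [msa|msa]; first by apply: vw => //; exact: ltnW.
  apply: (IH (Ordinal an)); first by rewrite /=; lia.
  by apply: leq_trans va _; apply/ltnW/asc.
have [np|pn] := leqP n p; first by rewrite !cnt_full.
have [->|p0] := posnP p; first by rewrite cnt0.
case: (boolP (ms p)) => [msp|msp]; first by apply: vw => //; exact: ltnW.
have p1n : (p.-1 < n)%N by lia.
have lt : (v (Ordinal p1n) < v (Ordinal pn))%N by apply: asc => //=; rewrite prednK.
have [va|va] := ltnP (v (Ordinal p1n)) q.
  by have := D _ va; rewrite /= prednK.
by apply: (U (Ordinal pn)); exact: leq_trans va (ltnW lt).
Qed.
End Inversions.

(** Among the rearrangements [u] preserving the prescribed dimensions, one minimising the inversions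
    of [u * v] leaves no descent inside a block: this is the minimal coset representative, to which
    [cnt_le_blocks] applies. *)
Lemma flag_lift (C : fieldType) n (ms : pred nat) (w : 'S_n) (g0 : 'M[C]_n) :
  g0 \in unitmx ->
  (forall p q, ms p -> (p <= n)%N -> (rk g0 p q <= cnt w p q)%N) ->
  exists g : 'M[C]_n, [/\ g \in unitmx, (forall p q, (rk g p q <= cnt w p q)%N) &
    forall p, ms p -> (p <= n)%N -> (toprows p g^T == toprows p g0^T)%MS].
Proof.
move=> gU rkg0; have [b1 [b2 [v [B1 B2 e]]]] := bruhat_decomposition gU.
pose st (u : 'S_n) := [forall m : 'I_n.+1, ms m ==> [forall x : 'I_n, (u x < m)%N == (x < m)%N]].
have st1 : st 1%g.
  by apply/forallP => m; apply/implyP => _; apply/forallP => x; rewrite perm1.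
case: (arg_minnP (P := st) (fun u => ninv (u * v)%g) st1) => u stu umin.
have us p x : ms p -> (p <= n)%N -> (u x < p)%N = (x < p)%N.
  move=> msp pn; have /forallP/(_ (Ordinal (pn : (p < n.+1)%N))) := stu.
  by rewrite /= msp => /forallP/(_ x)/eqP.
have asc (a b : 'I_n) : b = a.+1 :> nat -> ~~ ms b -> ((u * v)%g a < (u * v)%g b)%N.
  move=> ba msb; rewrite ltnNge leq_eqVlt; apply/negP => /orP[/eqP/val_inj/perm_inj ab|lt].
    by move: ba; rewrite ab; lia.
  have := umin (tperm a b * u)%g; rewrite leqNgt -mulgA.
  have -> : (ninv (tperm a b * (u * v)) < ninv (u * v))%N.
    rewrite -{2}(mulKg (tperm a b) (u * v)%g) tpermV; apply: ninv_tperm => //.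
    by rewrite (permM (tperm a b)) tpermL (permM (tperm a b)) tpermR.
  suff -> : st (tperm a b * u)%g by move/(_ isT).
  apply/forallP => m; apply/implyP => msm; apply/forallP => x.
  rewrite permM us // ?tperm_adj_lt // -1?ltnS //.
  by apply: contraNneq msb => <-.
have B1i := inB_inv B1.
(* As [pmat v = b1 *m g0 *m b2], this [g] is [g0 *m X], and [X] preserves the prescribed coordinate
   subspaces; the ranks of [g] are exactly the counts of [u * v]. *)
pose g : 'M[C]_n := invmx b1 *m pmat C (u * v)%g.
pose X := b2 *m pmat C u.
have XU : X \in unitmx by rewrite unitmx_mul pmat_unit; case: B2 => _ ->.
have gE : g = g0 *m X.
  by rewrite /g /X pmatM -e !mulmxA mulVmx ?mul1mx //; case: B1.
have same p : ms p -> (p <= n)%N -> (toprows p g^T == toprows p g0^T)%MS.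
  move=> msp pn; rewrite gE; apply: toprows_stable => //.
  apply/matrixP => j k; rewrite cornerE [RHS]mxE; case: ifP => // /andP[pj kp].
  by rewrite /X mul_pmat; case: B2 => ub _; apply: ub; apply: leq_trans pj; rewrite us.
exists g; split=> //; first by rewrite gE unitmx_mul gU.
have rkgv p q : rk g p q = cnt (u * v)%g p q.
  apply/eqP; rewrite eqn_leq; apply/andP; split.
    by apply: rk_bcell; exists (invmx b1), 1%:M; split; rewrite ?mulmx1 //; exact: inB1.
  have -> : cnt (u * v)%g p q = rk (b1 *m g *m 1%:M) p q.
    by rewrite mulmx1 /g mulmxA mulmxV ?mul1mx ?rk_pmat //; case: B1.
  by apply: rk_upper; [case: B1|case: (inB1 C n)].
move=> p q; rewrite rkgv; apply: (cnt_le_blocks asc) => p' q' msp pn.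
by rewrite -rkgv rkE (eqmxMr _ (eqmxP (same p' msp pn))) -rkE rkg0.
Qed.

(** * Intermediate subspaces *)

Section Refinement.
Variables (C : fieldType) (n : nat).

Lemma rank_ker_ge m p q (F : 'M[C]_(m, n)) (V : 'M[C]_(p, n)) (K : 'M[C]_(n, q)) :
  (V <= F)%MS -> V *m K = 0 -> (\rank (F *m K) + \rank V <= \rank F)%N.
Proof.
move=> VF VK; rewrite -(mxrank_mul_ker F K) leq_add2l mxrankS //.
by rewrite sub_capmx VF; apply/sub_kermxP.
Qed.

Lemma rank_lt_ker m q (F : 'M[C]_(m, n)) (K : 'M[C]_(n, q)) :
  (\rank (F *m K) < \rank F)%N <-> exists z : 'rV[C]_n, [/\ z != 0, (z <= F)%MS & z *m K = 0].
Proof.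
split=> [lt|[z [z0 zF zK]]]; last first.
  by apply: leq_trans (rank_ker_ge zF zK); rewrite -addn1 leq_add2l lt0n mxrank_eq0.
have /rowV0Pn[z zF z0] : (F :&: kermx K)%MS != 0.
  by rewrite -mxrank_eq0 -lt0n; have := mxrank_mul_ker F K; lia.
by move: zF; rewrite sub_capmx => /andP[zF /sub_kermxP zK]; exists z.
Qed.

(** Write E for the span of the first [q] basis vectors. In the generic case F is the direct sum of
    A and F cap E, and u + v is the decomposition of a vector of F killed by [pid_mx i]. The pairs
    with u + v = 0 record that A meets B cap E, which leaves enough freedom in the choice of F. *)
Lemma refinement_vectors (a b i ma mb : nat) (A : 'M[C]_(ma, n)) (B : 'M[C]_(mb, n)) :
  \rank A = a -> \rank B = b -> (A <= B)%MS -> (a < i < b)%N ->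
  let q := (n - b + (i - a))%N in
  (exists F : 'M[C]_n, [/\ (A <= F)%MS && (F <= B)%MS, \rank F = i,
     (\rank (F *m copid_mx q) <= a)%N & (\rank (F *m (pid_mx i : 'M[C]_n)) < i)%N]) <->
  (exists u v : 'rV[C]_n, [/\ (u != 0) || (v != 0), (u <= A)%MS, (v <= B)%MS,
     v *m copid_mx q = 0 & (u + v) *m (pid_mx i : 'M[C]_n) = 0]).
Proof.
move=> rA rB sAB /andP[ai ib] q.
have bn : (b <= n)%N by rewrite -rB rank_leq_col.
have qn : (q <= n)%N by rewrite /q; lia.
have iN : (i <= n)%N := ltnW (leq_trans ib bn).
split=> [[F [/andP[AF FB] rF rc rp]]|[u [v [uv uA vB vc uvp]]]].
  pose K := (F :&: kermx (copid_mx q : 'M[C]_n))%MS.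
  have KF : (K <= F)%MS := capmxSl _ _.
  have Kc (z : 'rV[C]_n) : (z <= K)%MS -> z *m copid_mx q = 0.
    by rewrite sub_capmx => /andP[_ /sub_kermxP].
  have rK : (i - a <= \rank K)%N by have := mxrank_mul_ker F (copid_mx q); rewrite -/K rF; lia.
  (* A common nonzero vector gives the pair (u, -u) at once; otherwise a dimension count makes F the
     sum of A and K. *)
  case: (eqVneq (A :&: K)%MS 0) => [AK|/rowV0Pn[u]]; last first.
    rewrite sub_capmx => /andP[uA uK] u0; exists u, (- u); split=> //.
    - by rewrite u0.
    - by rewrite eqmx_opp (submx_trans uK) // (submx_trans KF).
    - by rewrite mulNmx Kc // oppr0.
    - by rewrite subrr mul0mx.
  have sAK : (A + K <= F)%MS by rewrite addsmx_sub AF.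
  have FAK : (F <= A + K)%MS.
    rewrite -(geq_leqif (mxrank_leqif_sup sAK)) rF.
    by have := mxrank_sum_cap A K; rewrite AK mxrank0 rA; lia.
  have [z [z0 zF zp]] : exists z : 'rV[C]_n,
      [/\ z != 0, (z <= F)%MS & z *m (pid_mx i : 'M[C]_n) = 0].
    by apply/rank_lt_ker; rewrite rF.
  have /sub_addsmxP[[x y] /= e] := submx_trans zF FAK.
  exists (x *m A), (y *m K); split=> //; rewrite ?submxMl -?e //.
  - by apply: contraNT z0; rewrite negb_or !negbK e => /andP[/eqP-> /eqP->]; rewrite addr0.
  - by rewrite (submx_trans (submxMl _ _)) // (submx_trans KF).
  - by rewrite Kc // submxMl.
pose K := (B :&: kermx (copid_mx q : 'M[C]_n))%MS.
have vK : (v <= K)%MS by rewrite sub_capmx vB; apply/sub_kermxP.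
have rK : (i - a <= \rank K)%N.
  have := mxrank_mul_ker B (copid_mx q : 'M[C]_n); rewrite -/K rB.
  by have := mxrankM_maxr B (copid_mx q : 'M[C]_n); rewrite rank_copid_mx // /q; lia.
have rv1 := rank_leq_row v.
have [V [vV VK rV]] : exists V : 'M[C]_n, [/\ (v <= V)%MS, (V <= K)%MS & \rank V = (i - a)%N].
  by apply: subspace_between => //; rewrite rK andbT; lia.
have VB : (V <= B)%MS := submx_trans VK (capmxSl _ _).
have Vc : V *m copid_mx q = 0 by apply/sub_kermxP; exact: submx_trans VK (capmxSr _ _).
(* If u + v is nonzero it serves as z and already lies in A + V. If it vanishes, v is a nonzero
   vector of A cap V, so A + V has dimension below [i] and there is room for any z in B killed by
   [pid_mx i]; one exists as [b > i]. *)
have [z [z0 zB zp rz]] : exists z : 'rV[C]_n, [/\ z != 0, (z <= B)%MS,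
    z *m (pid_mx i : 'M[C]_n) = 0 & (\rank (A + V + z)%MS <= i)%N].
  have := mxrank_sum_cap A V; rewrite rA rV => rAV.
  case: (eqVneq (u + v) 0) => [uv0|uv0]; last first.
    exists (u + v); split=> //; first by rewrite addmx_sub // (submx_trans uA).
    have sz : ((u + v)%R <= A + V)%MS by rewrite addmx_sub_adds.
    by rewrite (addsmx_idPl sz); move: rAV ai; clear; lia.
  have v0 : v != 0.
    apply: contraTneq uv => v0; move: uv0; rewrite v0 addr0 => ->.
    by rewrite eqxx.
  have vA : (v <= A)%MS.
    by move/eqP: uv0; rewrite addrC addr_eq0 => /eqP ->; rewrite eqmx_opp.
  have cap : (0 < \rank (A :&: V)%MS)%N.
    rewrite lt0n mxrank_eq0; apply/rowV0Pn; exists v => //.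
    by rewrite sub_capmx vA.
  have [z [z0 zB zp]] : exists z : 'rV[C]_n,
      [/\ z != 0, (z <= B)%MS & z *m (pid_mx i : 'M[C]_n) = 0].
    apply/rank_lt_ker; rewrite rB; apply: leq_ltn_trans ib.
    by apply: leq_trans (mxrankM_maxr _ _) _; rewrite rank_pid_mx.
  exists z; split=> //; apply: leq_trans (mxrank_adds_leqif _ _) _.
  by have := rank_leq_row z; move: rAV ai cap; clear; lia.
have [F [sF FB rF]] : exists F : 'M[C]_n,
    [/\ (A + V + z <= F)%MS, (F <= B)%MS & \rank F = i].
  by apply: subspace_between; rewrite ?addsmx_sub ?sAB ?VB ?zB // rz rB ltnW.
move: sF; rewrite !addsmx_sub => /andP[/andP[AF VF] zF].
exists F; split; rewrite ?AF //.
  by have := rank_ker_ge VF Vc; rewrite rF rV; move: ai; clear; lia.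
by rewrite -{2}rF; apply/rank_lt_ker; exists z.
Qed.
End Refinement.

(** * Laplace expansion along the first rows *)

Section Laplace.
Variable C : fieldType.
Implicit Types (N : nat) (f g h : nat -> nat -> C) (s t : seq nat).

(** Entries are indexed by natural numbers, so that columns can be selected by lists and sizes
    changed without casts. *)
Definition detf N f : C := \det (\matrix_(r < N, c < N) f r c).

Lemma eq_detf N f g : (forall r c, (r < N)%N -> (c < N)%N -> f r c = g r c) ->
  detf N f = detf N g.
Proof. by move=> fg; congr (\det _); apply/matrixP => r c; rewrite !mxE fg. Qed.

Lemma detfE N f : detf N f = \sum_(s : 'S_N) (-1) ^+ s * \prod_(c < N) f (s c) c.
Proof.
rewrite /detf -det_tr; apply: eq_bigr => s _; congr (_ * _).
by apply: eq_bigr => c _; rewrite !mxE.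
Qed.

(** Multilinearity in the first [l] columns; [J] is the set of columns taking the summand [f]. *)
Lemma detf_expand l N f g h : (l <= N)%N ->
  detf N (fun r c => if (c < l)%N then f r c + g r c else h r c) =
  \sum_(J : {set 'I_l}) detf N (fun r c => if (c < l)%N then
      (if c \in [seq val x | x in J] then f r c else g r c) else h r c).
Proof.
move=> lN; under eq_bigr => J _ do rewrite detfE.
rewrite exchange_big detfE /=; apply: eq_bigr => s _; rewrite -mulr_sumr; congr (_ * _).
rewrite -(subnKC lN) in s *; rewrite big_split_ord /=.
under [X in X * _]eq_bigr => c _ do rewrite ltn_ord.
under [X in _ * X]eq_bigr => c _ do rewrite ltnNge leq_addr /=.
rewrite bigA_distr mulr_suml.
apply: eq_bigr => J _; rewrite big_split_ord /=; congr (_ * _); apply: eq_bigr => c _.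
  by rewrite ltn_ord (mem_image val_inj).
by rewrite ltnNge leq_addr.
Qed.

Lemma detf_swap N f (a b : 'I_N) : a != b ->
  detf N (fun r c => f r (if c == a then val b else if c == b then val a else c)) = - detf N f.
Proof.
move=> ab; rewrite /detf.
have -> : \matrix_(r < N, c < N) f r (if c == a :> nat then val b else if c == b :> nat then val a else c)
    = xcol a b (\matrix_(r < N, c < N) f r c).
  apply/matrixP => r c; rewrite !mxE; congr (f _ _); rewrite !val_eqE.
  by case: tpermP => [->|->|/eqP/negbTE -> /eqP/negbTE ->]; rewrite ?eqxx //; case: eqVneq => // ->.
by rewrite xcolE det_mulmx det_perm odd_tperm ab mulrN1.
Qed.

Definition detc N (col : nat -> nat -> C) s := detf N (fun r c => col (nth 0%N s c) r).

Lemma detc_swap N col s x y t : (size s + size t).+2 = N ->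
  detc N col (s ++ x :: y :: t) = - detc N col (s ++ y :: x :: t).
Proof.
move=> sN; have aN : (size s < N)%N by lia.
have bN : ((size s).+1 < N)%N by lia.
rewrite /detc -(@detf_swap _ _ (Ordinal aN) (Ordinal bN)); last by rewrite -val_eqE /= ltn_eqF.
apply: eq_detf => r c rN cN /=; congr (col _ _); rewrite !nth_cat.
case: (ltngtP c (size s)) => [cs|cs|->].
- by rewrite ltn_eqF ?cs // ltnW.
- case: eqVneq => [->|cs']; first by rewrite ltnn subSnn subnn.
  rewrite ltnNge (ltnW cs) /=.
  have -> : (c - size s)%N = (c - (size s).+2).+2 by move/eqP: cs'; lia.
  by [].
by rewrite ltnNge leqnSn /= subSnn subnn.
Qed.

Lemma detc_move N col s x t t' : (size s + size t + size t').+1 = N ->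
  detc N col (s ++ x :: t ++ t') = (-1) ^+ size t * detc N col (s ++ t ++ x :: t').
Proof.
elim: t s => [|y t IH] s /= sN; first by rewrite expr0 mul1r.
rewrite detc_swap ?size_cat; last by lia.
rewrite -cat_rcons IH ?size_rcons; last by lia.
by rewrite cat_rcons exprS mulN1r mulNr.
Qed.

(** Counts the pairs formed by an element of [J] and a later element outside [J]: the length of the
    shuffle moving [J] behind its complement. *)
Fixpoint shuffle_inv (J : pred nat) s : nat :=
  if s is x :: s' then ((if J x then count (predC J) s' else 0) + shuffle_inv J s')%N else 0%N.

Lemma detc_unshuffle N col J p s t : (size p + size s + size t)%N = N ->
  detc N col (p ++ s ++ t) = (-1) ^+ shuffle_inv J s *
    detc N col (p ++ filter (predC J) s ++ filter J s ++ t).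
Proof.
elim: s p => [|x s IH] p /= sN; first by rewrite expr0 mul1r.
rewrite -cat_rcons IH ?size_rcons; last by lia.
case: (boolP (J x)) => Jx /=; last by rewrite add0n cat_rcons.
rewrite -size_filter exprD cat_rcons detc_move ?size_cat; last first.
  by rewrite -sN addnA -[X in _ = (_ + X + _)%N]/(size s).+1 -(count_predC J s) -!size_filter; lia.
by rewrite mulrCA mulrA.
Qed.

(* Every inversion created by x in J is a later index outside J, of which there are
   (end - x - 1) minus the number of later elements of J. *)
Lemma shuffle_inv_iota J (s0 m : nat) :
  (shuffle_inv J (iota s0 m) + \sum_(x <- filter J (iota s0 m)) x
    + \sum_(j < count J (iota s0 m)) j = count J (iota s0 m) * (s0 + m).-1)%N.
Proof.
elim: m s0 => [|m IH] s0 /=; first by rewrite big_nil big_ord0.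
have := IH s0.+1; have := count_predC J (iota s0.+1 m); rewrite size_iota.
case: (J s0) => /=; last by rewrite !add0n addnS => _ ->.
rewrite big_cons add1n big_ord_recr /= addnS mulSn /=.
set c := count J _; set c' := count _ _; lia.
Qed.

Lemma detf_block a b f : (forall r c, (a <= r)%N -> (c < a)%N -> f r c = 0) ->
  detf (a + b) f = detf a f * detf b (fun r c => f (a + r)%N (a + c)%N).
Proof.
move=> f0; rewrite /detf.
rewrite -(det_ublock _ (\matrix_(r < a, c < b) f r (a + c)%N)); congr (\det _).
rewrite -[LHS]submxK; congr block_mx.
- by apply/matrixP => r c; rewrite !mxE.
- by apply/matrixP => r c; rewrite !mxE.
- by apply/matrixP => r c; rewrite !mxE f0 //= leq_addr.
- by apply/matrixP => r c; rewrite !mxE.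
Qed.

(** Frobenius-Koenig: by counting, every permutation meets the zero block, so every term of the
    determinant has a zero factor. *)
Lemma detf_zero_block N f (R S : {set 'I_N}) :
  (forall r c, r \in R -> c \in S -> f r c = 0) -> (N < #|R| + #|S|)%N -> detf N f = 0.
Proof.
move=> f0 big; rewrite detfE big1 // => s _.
case: (boolP [exists c in S, s c \in R]) => [/exists_inP[c cS scR]|].
  by rewrite (bigD1 c) //= f0 // mul0r mulr0.
rewrite negb_exists_in => /forall_inP no.
have : s @: S \subset ~: R.
  by apply/subsetP => x /imsetP[c cS ->]; rewrite inE no.
move/subset_leq_card; rewrite card_imset; last exact: perm_inj.
by have := cardsC R; rewrite card_ord; lia.
Qed.

Lemma card_ord_lt N a : (a <= N)%N -> #|[set r : 'I_N | (r < a)%N]| = a.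
Proof.
move=> aN; have inj : injective (widen_ord aN) by move=> x y /(congr1 val) /= /val_inj.
rewrite -[RHS](card_ord a) -(card_imset _ inj).
apply: eq_card => r; rewrite inE; apply/idP/imsetP => [ra|[x _ ->]]; last by rewrite /=.
by exists (Ordinal ra) => //; exact: val_inj.
Qed.

Lemma card_ord_ge N a : (a <= N)%N -> #|[set r : 'I_N | (a <= r)%N]| = (N - a)%N.
Proof.
move=> aN; have := cardsC [set r : 'I_N | (r < a)%N]; rewrite card_ord_lt // card_ord.
have -> : ~: [set r : 'I_N | (r < a)%N] = [set r : 'I_N | (a <= r)%N].
  by apply/setP => r; rewrite !inE -leqNgt.
by move: #|_|; lia.
Qed.

Lemma filter_iota_image l i (J : {set 'I_l}) : (l <= i)%N ->
  [seq c <- iota 0 i | c \in [seq val x | x in J]] = [seq val x | x in J].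
Proof.
move=> li; apply: (irr_sorted_eq ltn_trans ltnn).
- exact: (sorted_filter ltn_trans _ (iota_ltn_sorted 0 i)).
- have sub : subseq [seq val x | x in J] (iota 0 l).
    rewrite -val_enum_ord; apply: map_subseq.
    have -> : enum J = filter (mem J) (enum 'I_l) by rewrite enumT.
    exact: filter_subseq.
  exact: (subseq_sorted ltn_trans sub (iota_ltn_sorted 0 l)).
- move=> c; rewrite mem_filter mem_iota; case: (boolP (c \in _)) => //= /mapP[x _ ->].
  by rewrite add0n (leq_trans (ltn_ord x) li).
Qed.

(** Rows of [A] stand above rows of [B], and a left kernel vector is a pair (u, v). The first [i]
    columns say that u + v vanishes there, the others that v vanishes from [q] on. With [l] the
    minimum of [i] and [q], the [B] entries in columns from [l] to [i] may be put to 0, as v is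
    already zero there. *)
Definition laplace_mx (A B : nat -> nat -> C) a i l q r c : C :=
  if (c < l)%N then (if (r < a)%N then A r c else B (r - a)%N c)
  else if (c < i)%N then (if (r < a)%N then A r c else 0)
  else (if (r < a)%N then 0 else B (r - a)%N (q + (c - i))%N).

(** Each of the first [l] columns splits into an [A] part and a [B] part, and [J] collects those
    taking the [B] part. Once these are moved behind the others, the matrix is block diagonal if [J]
    has [k] elements and has too large a zero block otherwise. *)
Lemma laplace_expansion (A B : nat -> nat -> C) a b i l q (k := (i - a)%N) :
  (a <= i)%N -> (k <= b)%N -> (l <= i)%N ->
  detf (a + b) (laplace_mx A B a i l q) =
  (-1) ^+ (k + \sum_(j < k) j + k * i.-1) *
  \sum_(J : {set 'I_l} | #|J| == k) (-1) ^+ (\sum_(x in J) (val x).+1) *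
     detf a (fun r c => A r (nth 0%N [seq y <- iota 0 i | y \notin [seq val x | x in J]] c)) *
     detf b (fun r c => B r (nth 0%N ([seq val x | x in J] ++ iota q (b - k)) c)).
Proof.
move=> ai kb li; set N := (a + b)%N; have iN : (i <= N)%N by rewrite /N /k in kb *; lia.
pose f r c := if (r < a)%N then 0 else B (r - a)%N c.
pose g r c := if (r < a)%N then A r c else 0.
pose h r c := if (c < i)%N then g r c else f r (q + (c - i))%N.
have -> : detf N (laplace_mx A B a i l q) =
    detf N (fun r c => if (c < l)%N then f r c + g r c else h r c).
  apply: eq_detf => r c _ _; rewrite /laplace_mx /h /f /g.
  by do 2 case: ifP => //; rewrite ?addr0 ?add0r.
rewrite detf_expand ?(leq_trans li iN) // mulr_sumr [RHS]big_mkcond /=.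
apply: eq_bigr => J _; set inJ := [seq val x | x in J].
pose col c r := if (c < i)%N then (if c \in inJ then f r c else g r c) else f r (q + (c - i))%N.
have inJl c : c \in inJ -> (c < l)%N by move=> /mapP[x _ ->]; exact: ltn_ord.
have -> : detf N (fun r c => if (c < l)%N then if c \in inJ then f r c else g r c else h r c) =
    detc N col ([::] ++ iota 0 i ++ iota i (N - i)).
  apply: eq_detf => r c _ cN; rewrite -{1}(add0n i) /= -iotaD subnKC // nth_iota // add0n.
  rewrite /col /h; case: (ltnP c l) => cl; first by rewrite (leq_trans cl li).
  by case: (boolP (c \in inJ)) => // /inJl; rewrite ltnNge cl.
rewrite (@detc_unshuffle _ _ (mem inJ)) /=; last by rewrite !size_iota subnKC.
have vE : [seq c <- iota 0 i | mem inJ c] = inJ by exact: filter_iota_image.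
rewrite vE; set u := [seq c <- iota 0 i | _].
have szJ : size inJ = #|J| by rewrite size_image.
have cntJ : count (mem inJ) (iota 0 i) = #|J| by rewrite -size_filter vE szJ.
have szu : (size u + #|J|)%N = i.
  by rewrite addnC -cntJ size_filter count_predC size_iota.
have nthu c : (c < size u)%N -> (nth 0%N u c < i)%N && (nth 0%N u c \notin inJ).
  by move=> cu; have := mem_nth 0%N cu; rewrite mem_filter mem_iota /= andbC.
have colu c r : (c < size u)%N -> col (nth 0%N (u ++ inJ ++ iota i (N - i)) c) r = g r (nth 0%N u c).
  by move=> cu; rewrite nth_cat cu; case/andP: (nthu _ cu) => lt ni; rewrite /col lt (negbTE ni).
have colv c r : (size u <= c)%N -> (c < N)%N -> col (nth 0%N (u ++ inJ ++ iota i (N - i)) c) r =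
    f r (nth 0%N (inJ ++ iota q (N - i)) (c - size u)).
  move=> uc cN; rewrite nth_cat ltnNge uc /= !nth_cat.
  case: ltnP => cJ.
    have mJ := mem_nth 0%N cJ; rewrite /col mJ.
    by rewrite (leq_trans (inJl _ mJ) li).
  have lt : (c - size u - size inJ < N - i)%N by rewrite szJ; lia.
  by rewrite !nth_iota // /col ltnNge leq_addr addKn.
case: eqP => [Jk|Jk]; last first.
  (* The [A] rows live on the [size u] leading columns only and the [B] rows on the rest, so unequal
     sizes leave a zero block. *)
  have nua : (size u <> a)%N by move=> ua; apply: Jk; rewrite /k -szu ua addKn.
  rewrite [detc _ _ _](_ : _ = 0) ?mulr0 //.
  have uN : (size u <= N)%N by move: szu iN; clear; lia.
  have aN : (a <= N)%N by rewrite leq_addr.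
  case: (ltngtP (size u) a) => [lt|lt|//].
    apply: (@detf_zero_block _ _ [set r : 'I_N | (r < a)%N] [set c : 'I_N | (size u <= c)%N]).
      by move=> r c; rewrite !inE => ra uc; rewrite colv // /f ra.
    by rewrite card_ord_lt // card_ord_ge //; move: lt uN; clear; lia.
  apply: (@detf_zero_block _ _ [set r : 'I_N | (a <= r)%N] [set c : 'I_N | (c < size u)%N]).
    by move=> r c; rewrite !inE => ra uc; rewrite colu // /g ltnNge ra.
  by rewrite card_ord_lt // card_ord_ge //; move: lt aN; clear; lia.
have szua : size u = a by apply/eqP; rewrite -(eqn_add2r k) -{1}Jk szu /k subnKC.
rewrite /detc detf_block; last by move=> r c ar ca; rewrite colu ?szua // /g ltnNge ar.
rewrite !mulrA; congr (_ * _ * _).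
(* The shuffle sign depends on [J] only through the sum of its elements; passing from 0-based to
   1-based elements adds [k], which the common sign compensates. *)
- have := shuffle_inv_iota (mem inJ) 0 i; rewrite vE cntJ Jk add0n.
  have -> : (\sum_(x in J) (val x).+1 = \sum_(x <- inJ) x + k)%N.
    rewrite -Jk -sum1_card /inJ big_image /= -big_split /=.
    by apply: eq_bigr => x _; rewrite addn1.
  set I := shuffle_inv _ _; set S := (\sum_(x <- inJ) x)%N; set T := (\sum_(j < k) j)%N.
  move=> <-; rewrite -exprD -signr_odd -[RHS]signr_odd; congr (_ ^+ _).
  by rewrite !oddD; case: (odd I); case: (odd S); case: (odd T); case: (odd k).
- by apply: eq_detf => r c ra ca; rewrite colu ?szua // /g ra.
- apply: eq_detf => r c rb cb; rewrite colv ?szua ?leq_addr ?ltn_add2l // /f.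
  rewrite ltnNge leq_addr /= addKn; congr (B _ (nth _ (_ ++ iota _ _) _)); last by rewrite addKn.
  by rewrite /N /k; move: ai kb; rewrite /k; clear; lia.
Qed.
End Laplace.

(** * Counting for the longest elements *)

Section Counting.
Variable n : nat.
Implicit Types (u v w : 'S_n).

Lemma card_ord_interval (lo hi : nat) : (hi <= n)%N ->
  #|[set x : 'I_n | (lo <= x < hi)%N]| = (hi - lo)%N.
Proof.
move=> hn; have [lh|hl] := leqP lo hi; last first.
  have -> : (hi - lo = 0)%N by lia.
  by apply: eq_card0 => x; rewrite !inE; lia.
have := card_ord_lt hn; rewrite -(cardsID [set x : 'I_n | (x < lo)%N]).
have -> : [set x : 'I_n | (x < hi)%N] :&: [set x : 'I_n | (x < lo)%N] = [set x : 'I_n | (x < lo)%N].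
  by apply/setP => x; rewrite !inE; lia.
have -> : [set x : 'I_n | (x < hi)%N] :\: [set x : 'I_n | (x < lo)%N] =
    [set x : 'I_n | (lo <= x < hi)%N].
  by apply/setP => x; rewrite !inE; lia.
by rewrite card_ord_lt ?(leq_trans lh hn) //; move: #|_|; lia.
Qed.

Lemma w0E : w0 n = revp n.
Proof. by apply/permP => x; apply: val_inj; rewrite permE /=; have := w0_rev x; lia. Qed.

Lemma cnt_w0 u p m : (m <= n)%N -> cnt (u * w0 n)%g p (n - m) = cntl u p m.
Proof. by move=> mn; rewrite w0E cnt_rev. Qed.

Lemma cntl1 p m : (p <= n)%N -> cntl (1%g : 'S_n) p m = minn p m.
Proof.
move=> pn; rewrite -[RHS](card_ord_lt (N := n)); last by lia.
by apply: eq_card => x; rewrite !inE perm1 leq_min.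
Qed.

Lemma cntl_stable_mul u v p m : (forall x, (u x < p)%N = (x < p)%N) ->
  cntl (u * v)%g p m = cntl v p m.
Proof.
move=> us; rewrite /cntl -[RHS](card_preimset _ (@perm_inj _ u)); apply: eq_card => x.
by rewrite !inE permM us.
Qed.

Lemma cntl_stable u p m : (p <= n)%N -> (forall x, (u x < p)%N = (x < p)%N) ->
  cntl u p m = minn p m.
Proof. by move=> pn us; rewrite -[u]mulg1 cntl_stable_mul // cntl1. Qed.

Lemma simp_stable i m x : (0 < i < n)%N -> m != i -> (simp n i x < m)%N = (x < m)%N.
Proof.
move=> /[dup] /andP[i0 _] /simp_tperm[a [b [ea eb ->]]] mi.
by apply: tperm_adj_lt; rewrite ?ea ?eb ?prednK.
Qed.

Lemma cntl_simp i p m : (0 < i < n)%N -> (p <= n)%N ->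
  cntl (simp n i) p m = if (p == i) && (m == i) then i.-1 else minn p m.
Proof.
move=> iN pn; case: (eqVneq p i) => [->|pi] /=; last by rewrite cntl_stable // => x; rewrite simp_stable.
case: (eqVneq m i) => [->|mi]; last first.
  rewrite -(cntl1 m (p := i)); last by lia.
  by apply: eq_card => x; rewrite !inE perm1 simp_stable.
rewrite -[RHS](card_ord_lt (N := n)); last by lia.
apply: eq_card => x; rewrite !inE.
have [a [b [ea eb ->]]] := simp_tperm iN.
by case: tpermP => [->|->|/eqP + /eqP]; rewrite -?val_eqE /= ?ea ?eb; lia.
Qed.

Section Block.
Variables (ns : seq nat) (a i b : nat).
(** [a] and [b] are the prescribed dimensions around [i], with 0 and [n] standing in at the two
    ends, so all positions of [i] outside [ns] are treated together. *)
Hypotheses (an : (a == 0%N) || (a \in ns)) (bn : (b == n) || (b \in ns)).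
Hypotheses (gap : forall m, m \in ns -> (m <= a)%N || (b <= m)%N) (aib : (a < i < b)%N) (bleN : (b <= n)%N).

Lemma wP_stable_lo x : (wP n ns x < a)%N = (x < a)%N.
Proof. by case/orP: an => [/eqP->|/wP_stable ->]. Qed.

Lemma wP_stable_hi x : (wP n ns x < b)%N = (x < b)%N.
Proof. by case/orP: bn => [/eqP->|/wP_stable ->//]; rewrite !ltn_ord. Qed.

Lemma wP_block (x : 'I_n) : (a <= x < b)%N -> (wP n ns x + x).+1 = (a + b)%N.
Proof.
apply: perm_decr_block => // [y|y z zy ay zb].
  by rewrite !(leqNgt a) wP_stable_lo wP_stable_hi.
apply: wP_descent => //; apply/negP => /gap; rewrite /= zy; move: ay zb; rewrite zy; lia.
Qed.

(** [wP] reverses the block, so the positions from [a] to [i - 1] take its top [i - a] values, all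
    at least [b - (i - a)]; only the first [a] positions can count. *)
Lemma cntl_wP_le : (cntl (wP n ns) i (b - (i - a)) <= a)%N.
Proof.
rewrite -[leqRHS](card_ord_lt (N := n)); last by lia.
apply/subset_leq_card/subsetP => x; rewrite !inE => /andP[xi].
by apply: contraTT; rewrite -!leqNgt => ax; have := @wP_block x; lia.
Qed.

(** With [cntl_wP_ge_lo] it bounds the remaining counts at dimension [i] from below, so that the one
    corner condition at [q] implies the others. In the block only the first [b - m] positions have
    values from [m] on. *)
Lemma cntl_wP_ge m : (a <= m)%N -> (i <= cntl (wP n ns) i m + (b - m))%N.
Proof.
move=> am; have iN : (i <= n)%N by lia.
rewrite -[leqLHS](card_ord_lt iN) /cntl.
have [mb|bm] := leqP m b; last first.
  have -> : (b - m = 0)%N by lia.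
  rewrite addn0.
  apply/subset_leq_card/subsetP => x; rewrite !inE => xi; rewrite xi /=.
  by apply: ltn_trans bm; rewrite wP_stable_hi; lia.
apply: leq_trans (_ : #|[set x : 'I_n | (x < i)%N && (wP n ns x < m)%N] :|:
   [set x : 'I_n | (a <= x < minn n (a + b - m))%N]| <= _)%N.
  apply/subset_leq_card/subsetP => x; rewrite !inE => xi; rewrite xi /=.
  have [ax|xa] := leqP a x; last by have := wP_stable_lo x; lia.
  by have := @wP_block x; have := ltn_ord x; lia.
apply: leq_trans (leq_card_setU _ _) _; rewrite leq_add2l card_ord_interval; last by lia.
by lia.
Qed.

Lemma cntl_wP_ge_lo m : (minn a m <= cntl (wP n ns) i m)%N.
Proof.
rewrite -(cntl_stable (u := wP n ns)); [|by lia|exact: wP_stable_lo].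
by apply/subset_leq_card/subsetP => x; rewrite !inE => /andP[xa ->]; rewrite andbT; lia.
Qed.
End Block.
End Counting.

(** * Vanishing of Pluecker coordinates *)

Section Plucker.
Variables (C : fieldType) (n : nat).

Lemma row_copid0 (v : 'rV[C]_n) q :
  v *m copid_mx q = 0 <-> forall c : 'I_n, (q <= c)%N -> v 0 c = 0.
Proof.
rewrite copid_diagE mul_mx_diag; split=> [/rowP H c qc|H].
  by have := H c; rewrite !mxE qc mulr1.
by apply/rowP => c; rewrite !mxE; case: leqP => [/H ->|]; rewrite ?mul0r ?mulr0.
Qed.

Lemma row_pid0 (v : 'rV[C]_n) i :
  v *m (pid_mx i : 'M[C]_n) = 0 <-> forall c : 'I_n, (c < i)%N -> v 0 c = 0.
Proof.
rewrite pid_diagE mul_mx_diag; split=> [/rowP H c qc|H].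
  by have := H c; rewrite !mxE qc mulr1.
by apply/rowP => c; rewrite !mxE; case: ltnP => [/H ->|]; rewrite ?mul0r ?mulr0.
Qed.

(** Coordinates are indexed from 1 and matrix columns from 0; [map S] makes the passage. *)
Lemma pluckerE p (M : 'M[C]_(p, n)) t : sorted ltn t ->
  plucker M (map S t) = detf (size t) (fun r c => mget M r (nth 0%N t c)).
Proof.
move=> st; rewrite /plucker sorted_sort; last 2 first.
- by move=> x y z; apply: leq_trans.
- by rewrite sorted_map; apply: sub_sorted st => x y /= /ltnW; rewrite ltnS.
rewrite -/(detf _ (fun a b => mget M a (nth 0%N (map S t) b).-1)) size_map.
by apply: eq_detf => r c _ ct; rewrite (nth_map 0%N).
Qed.

Lemma iotaS m k : iota m.+1 k = map S (iota m k).
Proof. by elim: k m => //= k IH m; rewrite IH. Qed.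

Lemma detf0P N (f : nat -> nat -> C) :
  detf N f = 0 <-> exists2 x : 'rV[C]_N, x != 0 &
    forall c, (c < N)%N -> \sum_(r < N) x 0 r * f r c = 0.
Proof.
split=> [/eqP/det0P[x x0 /rowP H]|[x x0 H]].
  exists x => // c cN; have := H (Ordinal cN); rewrite !mxE.
  by under eq_bigr => r _ do rewrite mxE.
apply/eqP/det0P; exists x => //; apply/rowP => c; rewrite !mxE -[RHS](H c) //.
by apply: eq_bigr => r _; rewrite mxE.
Qed.

Lemma mul_toprowsE p m (M : 'M[C]_(p, n)) (x : 'rV[C]_m) (c : 'I_n) :
  (x *m toprows m M) 0 c = \sum_(r < m) x 0 r * mget M r c.
Proof. by rewrite mxE; apply: eq_bigr => r _; rewrite mxE. Qed.

Lemma mul_toprows_eq0 p m (M : 'M[C]_(p, n)) (x : 'rV[C]_m) :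
  row_free (toprows m M) -> (x *m toprows m M == 0) = (x == 0).
Proof. by move=> fr; rewrite -[in LHS](mul0mx 1 (toprows m M)) (inj_eq (row_free_inj fr)). Qed.

Lemma plucker0P p (M : 'M[C]_(p, n)) t : sorted ltn t -> all (fun c => c < n)%N t ->
  row_free (toprows (size t) M) ->
  plucker M (map S t) = 0 <->
  exists u : 'rV[C]_n, [/\ u != 0, (u <= toprows (size t) M)%MS &
     forall c : 'I_n, (c : nat) \in t -> u 0 c = 0].
Proof.
move=> st /allP tn fr; rewrite pluckerE // detf0P; split.
  move=> [x x0 H]; exists (x *m toprows (size t) M); split.
  - by rewrite mul_toprows_eq0.
  - exact: submxMl.
  - move=> c ct; rewrite mul_toprowsE -(nth_index 0%N ct); apply: H.
    by rewrite index_mem.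
move=> [u [u0 /submxP[x ux] H]]; exists x; first by rewrite -(mul_toprows_eq0 _ fr) -ux.
move=> c ct; have cn := tn _ (mem_nth 0%N ct).
by have := H (Ordinal cn) (mem_nth 0%N ct); rewrite ux mul_toprowsE.
Qed.

Lemma laplace_kernel p (M : 'M[C]_(p, n)) a b i :
  (a < i < b)%N -> (b <= n)%N -> row_free (toprows a M) -> row_free (toprows b M) ->
  let q := (n - b + (i - a))%N in let l := minn i q in
  detf (a + b) (laplace_mx (mget M) (mget M) a i l q) = 0 <->
  (exists u v : 'rV[C]_n, [/\ (u != 0) || (v != 0), (u <= toprows a M)%MS,
     (v <= toprows b M)%MS, v *m copid_mx q = 0 & (u + v) *m (pid_mx i : 'M[C]_n) = 0]).
Proof.
move=> aib bn fa fb q l.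
have colE (x1 : 'rV[C]_a) (x2 : 'rV[C]_b) c : 
    \sum_(r < a + b) row_mx x1 x2 0 r * laplace_mx (mget M) (mget M) a i l q r c =
    (if (c < i)%N then \sum_(r < a) x1 0 r * mget M r c else 0) +
    (if (c < l)%N then \sum_(r < b) x2 0 r * mget M r c else
     if (c < i)%N then 0 else \sum_(r < b) x2 0 r * mget M r (q + (c - i))%N).
  rewrite big_split_ord /=; congr (_ + _).
    under eq_bigr => r _ do rewrite row_mxEl /laplace_mx /= ltn_ord.
    case: (ltnP c l) => cl; first by have -> : (c < i)%N by rewrite /l in cl; lia.
    by case: ltnP => // _; rewrite big1 // => r _; rewrite mulr0.
  under eq_bigr => r _ do rewrite row_mxEr /laplace_mx /= (ltnNge (a + r)) leq_addr /= addKn.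
  case: ltnP => // cl; case: ltnP => // _; rewrite big1 // => r _; rewrite mulr0 //.
have li : (l <= i)%N by rewrite /l; lia.
have lq : (l <= q)%N by rewrite /l; lia.
(* The number of equations, [i] on u + v and [n - q] on v, equals the number of rows. *)
have abE : (a + b = i + (n - q))%N by rewrite /q; lia.
rewrite detf0P; split.
  move=> [x x0 H]; rewrite -(hsubmxK x) in x0 H.
  set x1 := lsubmx x in x0 H; set x2 := rsubmx x in x0 H.
  exists (x1 *m toprows a M), (x2 *m toprows b M).
  have vq (c : 'I_n) : (q <= c)%N -> (x2 *m toprows b M) 0 c = 0.
    move=> qc; have := H (i + (c - q))%N; rewrite colE.
    have -> : (i + (c - q) < i)%N = false by lia.
    have -> : (i + (c - q) < l)%N = false by lia.
    rewrite add0r (_ : q + (i + (c - q) - i) = c)%N; last by lia.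
    by rewrite mul_toprowsE; apply; have := ltn_ord c; lia.
  split; rewrite ?submxMl //.
  - apply: contraNT x0; rewrite negb_or !negbK !mul_toprows_eq0 // => /andP[/eqP -> /eqP ->].
    by rewrite row_mx0.
  - by apply/row_copid0.
  - apply/row_pid0 => c ci; rewrite mxE [X in X + _]mul_toprowsE.
    have := H c; rewrite colE ci.
    case: (ltnP c l) => cl; first by rewrite mul_toprowsE; apply; lia.
    rewrite [in X in _ -> X]vq; last by rewrite /l in cl; lia.
    by apply; lia.
move=> [u [v [uv /submxP[x1 eu] /submxP[x2 ev] /row_copid0 vq /row_pid0 uvi]]].
exists (row_mx x1 x2).
  apply: contraTneq uv; rewrite -row_mx0 => /eq_row_mx[e1 e2].
  by rewrite eu ev e1 e2 !mul0mx eqxx.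
move=> c cN; rewrite colE; case: (ltnP c i) => ci.
  have cn : (c < n)%N by lia.
  have := uvi (Ordinal cn) ci; rewrite mxE {1}eu {1}mul_toprowsE /=.
  case: (ltnP c l) => cl; first by rewrite ev mul_toprowsE.
  have qc : (q <= c)%N by move: cl ci; rewrite /l; clear; lia.
  by rewrite (vq (Ordinal cn)).
have -> : (c < l)%N = false by lia.
have cn : (q + (c - i) < n)%N by lia.
have := vq (Ordinal cn); rewrite /= leq_addr => /(_ isT).
by rewrite ev mul_toprowsE add0r.
Qed.
End Plucker.

(** * Projected Richardson varieties *)

Section Assembly.
Variables (C : numFieldType) (n : nat).
Hypothesis n0 : (0 < n)%N.

Lemma toprows_inB p (g b : 'M[C]_n) : inB b -> (toprows p (g *m b)^T == toprows p g^T)%MS.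
Proof.
by move=> [ub bU]; apply: toprows_stable => //; exact: (upperP b).1.
Qed.

Lemma rk_copid_gt m (A : 'M[C]_(m, n)) q : (n <= q)%N -> \rank (A *m copid_mx q) = 0%N.
Proof.
move=> nq; apply/eqP; rewrite mxrank_eq0 copid_diagE mul_mx_diag; apply/eqP/matrixP => i j.
by rewrite !mxE leqNgt (leq_trans (ltn_ord j) nq) mulr0.
Qed.

Lemma rank_copid_le m (A : 'M[C]_(m, n)) q : (q <= n)%N -> (\rank (A *m copid_mx q) <= n - q)%N.
Proof. by move=> qn; apply: leq_trans (mxrankM_maxr _ _) _; rewrite rank_copid_mx. Qed.

Lemma rank_copid_mono m (A : 'M[C]_(m, n)) q q' : (q <= q')%N ->
  (\rank (A *m copid_mx q') <= \rank (A *m copid_mx q))%N.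
Proof.
move=> qq; have -> : copid_mx q' = copid_mx q *m copid_mx q' :> 'M[C]_n.
  rewrite !copid_diagE mul_mx_diag; apply/matrixP => i j; rewrite !mxE.
  case: eqVneq => [->|_]; last by rewrite !mulr0n mul0r.
  by case: (leqP q' j) => [jq|_]; rewrite ?mulr0 ?mul0rn // (leq_trans qq jq) mulr1.
by rewrite mulmxA mxrankM_maxl.
Qed.

Lemma rank_copid_add m (A : 'M[C]_(m, n)) q q' : (q <= n)%N -> (q' <= q)%N ->
  (\rank (A *m copid_mx q') <= \rank (A *m copid_mx q) + (q - q'))%N.
Proof.
move=> qn qq.
have -> : copid_mx q' = copid_mx q +
    diag_mx (\row_j (j \in [set x : 'I_n | (q' <= x < q)%N])%:R) :> 'M[C]_n.
  rewrite !copid_diagE -linearD; congr diag_mx; apply/rowP => j; rewrite !mxE inE.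
  by case: (leqP q j) => jq /=; rewrite ?andbF ?andbT ?addr0 ?add0r // (leq_trans qq jq).
rewrite mulmxDr; apply: leq_trans (mxrank_add _ _) _; rewrite leq_add2l.
by apply: leq_trans (mxrankM_maxr _ _) _; rewrite rank_indicator card_ord_interval.
Qed.

(** Completion to a full flag, rearrangement inside blocks and scaling to determinant 1 all keep the
    prescribed members. *)
Lemma exists_flag_in_Xup (ms : pred nat) (V : nat -> 'M[C]_n) (w : 'S_n) :
  (forall m, ms m -> (m <= n)%N) ->
  (forall m, ms m -> \rank (V m) = m) ->
  (forall m m', ms m -> ms m' -> (m <= m')%N -> (V m <= V m')%MS) ->
  (forall m q, ms m -> (\rank (V m *m copid_mx q) <= cnt w m q)%N) ->
  exists g, [/\ \det g = 1, Xup w g & forall m, ms m -> (toprows m g^T == V m)%MS].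
Proof.
move=> msn rV sV Vw.
have [h hU hV] : exists2 h : 'M[C]_n, h \in unitmx &
    forall m, ms m -> (m <= n)%N -> ((pid_mx m : 'M[C]_n) *m h == V m)%MS.
  by apply: flag_completion => [m /rV|m m' msm msm' /andP[]] //; move=> *; apply: sV.
have top m : ms m -> (toprows m h^T^T == V m)%MS.
  move=> msm; rewrite trmxK; apply/eqmxP.
  by apply: eqmx_trans (toprows_eqmx _ _) _; apply/eqmxP/hV => //; apply: msn.
have hTU : h^T \in unitmx by rewrite unitmx_tr.
have [g [gU rkg gV]] : exists g : 'M[C]_n, [/\ g \in unitmx,
    (forall p q, (rk g p q <= cnt w p q)%N) &
    forall p, ms p -> (p <= n)%N -> (toprows p g^T == toprows p h^T^T)%MS].
  by apply: flag_lift => // p q msp _; rewrite rkE (eqmxMr _ (eqmxP (top p msp))) Vw.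
have dg : \det g != 0 by rewrite -unitfE -unitmxE.
have Bd : inB (rescale_col0 n (\det g)^-1) by apply: inB_rescale; rewrite invr_eq0.
have d1 : \det (g *m rescale_col0 n (\det g)^-1) = 1.
  by rewrite det_mulmx det_rescale // mulfV.
exists (g *m rescale_col0 n (\det g)^-1); split=> //.
  apply/XupP => // p q; apply: leq_trans (rkg p q); rewrite -{1}(mul1mx g).
  by apply: rk_upper; [case: (inB1 C n) | case: Bd].
move=> m msm; apply/eqmxP; apply: eqmx_trans (eqmxP (toprows_inB m g Bd)) _.
exact: eqmx_trans (eqmxP (gV m msm (msn m msm))) (eqmxP (top m msm)).
Qed.

(** The counts of [s_i] differ from the trivial bounds min(p, m) at the corner [(i, i)] only. *)
Lemma Xlow_simp i (g : 'M[C]_n) : (0 < i < n)%N -> \det g = 1 ->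
  Xlow (simp n i) g <-> (\rank (toprows i g^T *m (pid_mx i : 'M[C]_n)) < i)%N.
Proof.
move=> iN dg; have iln : (i <= n)%N by lia.
rewrite XlowP //; split=> [H|H p m pn mn].
  rewrite -rank_pid_pid; apply: leq_ltn_trans (H i i iln iln) _.
  by rewrite cntl_simp // !eqxx /=; lia.
rewrite cntl_simp //; case: ifP => [/andP[/eqP-> /eqP->]|_].
  by rewrite rank_pid_pid -ltnS prednK //; case/andP: iN.
rewrite leq_min; apply/andP; split.
  by apply: leq_trans (mxrankM_maxr _ _) _; rewrite rank_pid_mx.
by apply: leq_trans (mxrankM_maxl _ _) _; apply: leq_trans (mxrankM_maxl _ _) _; rewrite rank_pid_mx.
Qed.

Lemma Xlow_id (g : 'M[C]_n) : \det g = 1 -> Xlow 1%g g.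
Proof.
move=> dg; apply/XlowP => // p m pn mn.
rewrite cntl1 // leq_min; apply/andP; split.
  by apply: leq_trans (mxrankM_maxr _ _) _; rewrite rank_pid_mx.
by apply: leq_trans (mxrankM_maxl _ _) _; apply: leq_trans (mxrankM_maxl _ _) _; rewrite rank_pid_mx.
Qed.

Variable ns : seq nat.
Hypotheses (ns_sorted : sorted ltn ns) (ns_pos : (0 < head 0 ns)%N) (ns_lt : (last 0 ns < n)%N).

Lemma mem_ns m : m \in ns -> (0 < m)%N && (m <= nr ns)%N.
Proof.
move=> mns; rewrite -(nth_index 0%N mns); set j := index m ns.
have jns : (j < size ns)%N by rewrite index_mem.
have le : sorted leq ns by apply: sub_sorted ns_sorted => x y /ltnW.
have mono := sorted_leq_nth leq_trans leqnn 0%N le.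
apply/andP; split.
  apply: leq_trans ns_pos _; rewrite -nth0; apply: mono; rewrite ?inE //; lia.
rewrite /nr -nth_last; apply: mono; rewrite ?inE //; lia.
Qed.

Section Point.
Variable M : 'M[C]_(nr ns, n).
Hypothesis rM : \rank M = nr ns.

Lemma rank_toprows m : (m <= nr ns)%N -> \rank (toprows m M) = m.
Proof.
move=> mn; rewrite toprows_pid mxrankMfree ?rank_pid_mx //.
by rewrite /row_free rM.
Qed.

Lemma toprows_free m : (m <= nr ns)%N -> row_free (toprows m M).
Proof. by move=> mn; rewrite /row_free rank_toprows. Qed.

Lemma toprows_mono p (A : 'M[C]_(p, n)) m m' : (m <= m')%N -> (m' <= p)%N ->
  (toprows m A <= toprows m' A)%MS.
Proof.
move=> mm mp; rewrite !toprows_pid.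
have -> : pid_mx m = (pid_mx m : 'M[C]_(m, m')) *m (pid_mx m' : 'M[C]_(m', p)).
  by rewrite mul_pid_mx; congr pid_mx; lia.
by rewrite -mulmxA submxMl.
Qed.

(** When [i] is prescribed there is no intermediate member to choose, and the condition is a
    property [P] of the [i]-dimensional one. [P] may come from either variety: it feeds the rank
    bounds through [rkP] and the opposite condition through [Psuf]. *)
Lemma inproj_at_node i (v w : 'S_n) (P : 'M[C]_(i, n) -> bool) :
  i \in ns ->
  (forall A B : 'M[C]_(i, n), (A == B)%MS -> P A = P B) ->
  (forall g, \det g = 1 -> Xlow v g -> Xup w g -> P (toprows i g^T)) ->
  (forall g, \det g = 1 -> P (toprows i g^T) -> Xlow v g) ->
  (P (toprows i M) -> forall m q, m \in ns -> (\rank (toprows m M *m copid_mx q) <= cnt w m q)%N) ->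
  inproj (Richardson v w) M <-> P (toprows i M).
Proof.
move=> ins Peq Pnec Psuf rkP; split=> [[g [[[dg lg] ug] fl]]|PM].
  rewrite (Peq _ _ (fl i ins)); exact: Pnec.
have [g [dg ug gV]] : exists g, [/\ \det g = 1, Xup w g &
    forall m, m \in ns -> (toprows m g^T == <<toprows m M>>)%MS].
  apply: exists_flag_in_Xup => [m /mem_ns/andP[_ mr]|m /mem_ns/andP[_ mr]|m m' _ /mem_ns/andP[_ mr] mm|m q mns].
  - exact: ltnW (leq_ltn_trans mr ns_lt).
  - by rewrite mxrank_gen rank_toprows.
  - by rewrite !genmxE toprows_mono.
  - by rewrite (eqmxMr _ (genmxE _)) rkP.
have fl m : m \in ns -> (toprows m M == toprows m g^T)%MS.
  move=> mns; apply/eqmxP/eqmx_sym; apply: eqmx_trans (eqmxP (gV m mns)) (genmxE _).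
exists g; split=> //; split=> //; apply: Psuf => //.
by rewrite -(Peq _ _ (fl i ins)).
Qed.

Lemma cnt_ns (v : 'S_n) m q : m \in ns -> (q <= n)%N ->
  cnt (wP n ns * v * w0 n)%g m q = cntl v m (n - q).
Proof.
move=> mns qn; rewrite -{1}(subKn qn) cnt_w0 ?leq_subr //.
by apply: cntl_stable_mul => x; rewrite wP_stable.
Qed.

(** At prescribed dimensions [w0 wP] imposes nothing: for [q <= n] its count is the trivial bound
    min(m, n - q). *)
Lemma cnt_ns_ge m q p (A : 'M[C]_(p, n)) : m \in ns -> (\rank A <= m)%N ->
  (\rank (A *m copid_mx q) <= cnt (wP n ns * w0 n)%g m q)%N.
Proof.
move=> mns rA; have [qn|nq] := leqP q n; last by rewrite rk_copid_gt // ltnW.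
have mn : (m <= n)%N by have /andP[_ mr] := mem_ns mns; exact: ltnW (leq_ltn_trans mr ns_lt).
rewrite -(mulg1 (wP n ns)) cnt_ns // cntl1 // leq_min rank_copid_le // andbT.
exact: leq_trans (mxrankM_maxl _ _) rA.
Qed.

(** Among the prescribed dimensions only the corner [(i, n - i)] has a bound below the generic rank:
    [s_i] lowers the count of the identity at [(i, i)] alone, and [w0] reverses the rows. *)
Lemma Xup_schubert_divisor i : i \in ns -> (i < n)%N ->
  inproj (Richardson 1%g (wmul (wmul (w0 n) (simp n i)) (wP n ns))) M <->
  plucker M (iota (n - i).+1 i) = 0.
Proof.
move=> ins iltn; have /andP[i0 ir] := mem_ns ins; have iN : (0 < i < n)%N by rewrite i0.
have -> : wmul (wmul (w0 n) (simp n i)) (wP n ns) = (wP n ns * simp n i * w0 n)%g.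
  by rewrite /wmul mulgA.
rewrite (inproj_at_node (i := i) (P := fun A => (\rank (A *m copid_mx (n - i)) < i)%N)) //.
- rewrite iotaS plucker0P ?iota_ltn_sorted ?size_iota ?toprows_free //; last first.
    by apply/allP => c; rewrite mem_iota; lia.
  have := rank_lt_ker (toprows i M) (copid_mx (n - i)); rewrite (rank_toprows ir) => ->.
  split=> -[z [z0 zM zc]]; exists z; split=> //.
    by move/row_copid0: zc => zc c; rewrite mem_iota => /andP[+ _]; exact: zc.
  by apply/row_copid0 => c qc; apply: zc; rewrite mem_iota qc; have := ltn_ord c; lia.
- by move=> A B AB; rewrite (eqmxMr _ (eqmxP AB)).
- move=> g dg _ /XupP -/(_ n0 dg i (n - i)%N); rewrite rkE cnt_ns ?leq_subr // subKn; last by lia.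
  rewrite cntl_simp ?eqxx /=; [|by []|exact: ltnW].
  by move/leq_ltn_trans; apply; rewrite prednK.
- by move=> g dg _; exact: Xlow_id.
- move=> rki m q mns; have /andP[_ mr] := mem_ns mns.
  have mn : (m <= n)%N := ltnW (leq_ltn_trans mr ns_lt).
  have [qn|nq] := leqP q n; last by rewrite rk_copid_gt // ltnW.
  rewrite cnt_ns // cntl_simp //; case: ifP => [/andP[/eqP mi /eqP qi]|_].
    have -> : q = (n - i)%N by lia.
    by rewrite mi -ltnS prednK.
  rewrite leq_min rank_copid_le // andbT; apply: leq_trans (mxrankM_maxl _ _) _.
  by rewrite rank_toprows.
Qed.

Lemma Xlow_schubert_divisor i : i \in ns -> (i < n)%N ->
  inproj (Richardson (simp n i) (wmul (w0 n) (wP n ns))) M <-> plucker M (iota 1 i) = 0.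
Proof.
move=> ins iltn; have /andP[i0 ir] := mem_ns ins; have iN : (0 < i < n)%N by rewrite i0.
rewrite (inproj_at_node (i := i) (P := fun A => (\rank (A *m (pid_mx i : 'M[C]_n)) < i)%N)) //.
- rewrite iotaS plucker0P ?iota_ltn_sorted ?size_iota ?toprows_free //; last first.
    by apply/allP => c; rewrite mem_iota; lia.
  have := rank_lt_ker (toprows i M) (pid_mx i : 'M[C]_n); rewrite (rank_toprows ir) => ->.
  split=> -[z [z0 zM zc]]; exists z; split=> //.
    by move/row_pid0: zc => zc c; rewrite mem_iota => /andP[_]; exact: zc.
  by apply/row_pid0 => c qc; apply: zc; rewrite mem_iota.
- by move=> A B AB; rewrite (eqmxMr _ (eqmxP AB)).
- by move=> g dg /Xlow_simp - /(_ iN dg).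
- by move=> g dg H; apply/Xlow_simp.
- move=> _ m q mns; apply: cnt_ns_ge => //.
  by rewrite rank_toprows //; case/andP: (mem_ns mns).
Qed.

Section Block.
Variables (a i b : nat).
Hypotheses (an : (a == 0%N) || (a \in ns)) (bn : (b == n) || (b \in ns)).
Hypotheses (gap : forall m, m \in ns -> (m <= a)%N || (b <= m)%N) (aib : (a < i < b)%N).

(** For [b = n] the upper neighbour is the whole space, which [M], having fewer than [n] rows, does
    not supply. *)
Definition upper_step : 'M[C]_n := if b == n then 1%:M else <<toprows b M>>%MS.

Lemma a_le_nr : (a <= nr ns)%N.
Proof. by case/orP: an => [/eqP->|/mem_ns/andP[]]. Qed.

Lemma b_le_n : (b <= n)%N.
Proof.
case/orP: bn => [/eqP-> //|/mem_ns/andP[_ br]]; exact: ltnW (leq_ltn_trans br ns_lt).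
Qed.

Lemma rank_upper_step : \rank upper_step = b.
Proof.
rewrite /upper_step; case: eqVneq => [->|ne]; first by rewrite mxrank1.
by rewrite mxrank_gen rank_toprows //; move: bn; rewrite (negbTE ne) => /mem_ns/andP[].
Qed.

Lemma toprows_upper_step : (toprows a M <= upper_step)%MS.
Proof.
rewrite /upper_step; case: eqVneq => [_|ne]; first exact: submx1.
rewrite genmxE toprows_mono //; first by lia.
by move: bn; rewrite (negbTE ne) => /mem_ns/andP[].
Qed.

Lemma inproj_refine : let q := (n - b + (i - a))%N in
  inproj (Richardson (simp n i) (wmul (w0 n) (wP n ns))) M <->
  exists F : 'M[C]_n, [/\ (toprows a M <= F)%MS && (F <= upper_step)%MS, \rank F = i,
     (\rank (F *m copid_mx q) <= a)%N & (\rank (F *m (pid_mx i : 'M[C]_n)) < i)%N].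
Proof.
move=> q; have bN := b_le_n; have iN : (0 < i < n)%N by lia.
have ilen : (i <= n)%N by lia.
have qE : (n - q = b - (i - a))%N by rewrite /q; lia.
have qn : (q <= n)%N by rewrite /q; lia.
split=> [[g [[lg ug] fl]]|[F [/andP[AF FB] rF rc rp]]].
  have dg := proj1 lg; have gU : g^T \in unitmx by rewrite unitmx_tr unitmxE dg unitr1.
  have rg m : (m <= n)%N -> \rank (toprows m g^T) = m.
    by move=> mn; rewrite toprows_pid mxrankMfree ?rank_pid_mx // row_free_unit.
  exists <<toprows i g^T>>%MS; rewrite !genmxE !(eqmxMr _ (genmxE _)) rg //.
  split=> //; last by apply/Xlow_simp.
  - apply/andP; split.
      case/orP: an => [/eqP a0|ans].
        suff /eqP -> : toprows a M == 0 by exact: sub0mx.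
        by rewrite -mxrank_eq0 rank_toprows ?a_le_nr // a0.
      rewrite (eqmxP (fl a ans)); apply: toprows_mono => //; lia.
    rewrite /upper_step; case: eqVneq => [_|ne]; first exact: submx1.
    have bns : b \in ns by move: bn; rewrite (negbTE ne).
    rewrite genmxE (eqmxP (fl b bns)); apply: toprows_mono => //; lia.
  - rewrite -rkE; move/XupP: ug => /(_ n0 dg i q) /leq_trans; apply.
    rewrite -{1}(subKn qn) cnt_w0 ?leq_subr // qE.
    exact: (cntl_wP_le an bn gap aib bN).
have [g [dg ug gV]] : exists g, [/\ \det g = 1, Xup (wmul (w0 n) (wP n ns)) g &
    forall m, (m \in ns) || (m == i) ->
      (toprows m g^T == if m == i then F else <<toprows m M>>)%MS].
  have ms_le m : (m \in ns) || (m == i) -> (m <= n)%N.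
    case/orP => [/mem_ns/andP[_ mr]|/eqP -> //]; exact: ltnW (leq_ltn_trans mr ns_lt).
  have nsE m : (m \in ns) || (m == i) -> m != i -> m \in ns.
    by case/orP => // ->.
  apply: exists_flag_in_Xup => // [m msm|m m' msm msm' mm|m q' msm].
  - case: eqVneq => [-> //|ne]; rewrite mxrank_gen rank_toprows //.
    by case/andP: (mem_ns (nsE _ msm ne)).
  - case: (eqVneq m i) => [mi|mi]; case: (eqVneq m' i) => [mi'|mi'] //.
    + have m'ns := nsE _ msm' mi'; have := gap m'ns; have /andP[_ mr] := mem_ns m'ns.
      have m'n : (m' < n)%N := leq_ltn_trans mr ns_lt.
      rewrite genmxE => gp; apply: submx_trans FB _; rewrite /upper_step; case: eqVneq => [bE|_].
        by lia.
      by rewrite genmxE toprows_mono //; lia.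
    + have mns := nsE _ msm mi; have := gap mns => gp.
      by rewrite genmxE; apply: submx_trans AF; apply: toprows_mono; [lia | exact: a_le_nr].
    + by rewrite !genmxE toprows_mono //; case/andP: (mem_ns (nsE _ msm' mi')).
  - case: (eqVneq m i) => [->|mi]; last first.
      rewrite (eqmxMr _ (genmxE _)); apply: cnt_ns_ge; first exact: nsE.
      by rewrite rank_toprows //; case/andP: (mem_ns (nsE _ msm mi)).
    have [q'n|nq'] := leqP q' n; last by rewrite rk_copid_gt // ltnW.
    rewrite -{2}(subKn q'n) cnt_w0 ?leq_subr //.
    (* Below [q] the rank of F grows by at most one per added row, as the count of [w0 wP] does
       until it reaches [i]; above [q] the rank is at most [a] and at most [n - q']. *)
    have [qq|qq] := leqP q' q.
      have h1 := rank_copid_add F qn qq.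
      have am : (a <= n - q')%N by rewrite /q in qq; lia.
      have h2 := cntl_wP_ge an bn gap aib bN am.
      have h3 := mxrankM_maxl F (copid_mx q' : 'M[C]_n); rewrite rF in h3.
      move: h1 h2 h3 rc; rewrite /q in qq *.
      move: (\rank _) (\rank _) (cntl _ _ _) => x y z; move: qq q'n aib bN; clear; lia.
    have h := cntl_wP_ge_lo an bn aib bN (n - q')%N.
    apply: leq_trans h; rewrite leq_min rank_copid_le // andbT.
    exact: leq_trans (rank_copid_mono _ (ltnW qq)) rc.
have topE m : m \in ns -> m != i -> (toprows m M == toprows m g^T)%MS.
  move=> mns mi; apply/eqmxP/eqmx_sym; apply: eqmx_trans (eqmxP (gV m _)) _; first by rewrite mns.
  by rewrite (negbTE mi); exact: genmxE.
exists g; split; last first.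
  move=> m mns; apply: topE => //; apply: contraTneq mns => ->; apply/negP => /gap; lia.
split=> //; apply/Xlow_simp => //.
by have := gV i; rewrite eqxx orbT => /(_ isT)/eqmxP e; rewrite (eqmxMr _ e).
Qed.

Lemma inproj_vectors : let q := (n - b + (i - a))%N in
  inproj (Richardson (simp n i) (wmul (w0 n) (wP n ns))) M <->
  exists u v : 'rV[C]_n, [/\ (u != 0) || (v != 0), (u <= toprows a M)%MS,
     (v <= upper_step)%MS, v *m copid_mx q = 0 & (u + v) *m (pid_mx i : 'M[C]_n) = 0].
Proof.
move=> q; rewrite inproj_refine; apply: refinement_vectors => //.
- by rewrite rank_toprows ?a_le_nr.
- exact: rank_upper_step.
- exact: toprows_upper_step.
Qed.
End Block.

Lemma sorted_ltn_cat (s1 s2 : seq nat) : sorted ltn s1 -> sorted ltn s2 ->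
  (forall x y, x \in s1 -> y \in s2 -> (x < y)%N) -> sorted ltn (s1 ++ s2).
Proof.
rewrite !(sorted_pairwise ltn_trans) pairwise_cat => -> -> lt12; rewrite !andbT.
exact/allrelP.
Qed.

(** With [a = 0] the vector u is zero, and v must vanish on [i + (n - q) = b] columns: a single
    minor. *)
Lemma plucker_below i b : b \in ns -> (forall m, m \in ns -> (b <= m)%N) -> (0 < i < b)%N ->
  inproj (Richardson (simp n i) (wmul (w0 n) (wP n ns))) M <->
  plucker M (iota 1 i ++ iota (n - b + i).+1 (b - i)) = 0.
Proof.
move=> bns bmin iB; have /andP[_ br] := mem_ns bns; have bltn := leq_ltn_trans br ns_lt.
rewrite (@inproj_vectors 0 i b) ?bns ?orbT //; last by move=> m /bmin ->; rewrite orbT.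
rewrite subn0 /upper_step (ltn_eqF bltn); set q := (n - b + i)%N.
rewrite !iotaS -map_cat.
have szt : size (iota 0 i ++ iota q (b - i)) = b by rewrite size_cat !size_iota; lia.
rewrite plucker0P ?szt ?toprows_free //; last 2 first.
- apply: sorted_ltn_cat; rewrite ?iota_ltn_sorted // => x y.
  by rewrite !mem_iota /q; lia.
- by apply/allP => c; rewrite mem_cat !mem_iota /q; lia.
split=> [[u [v [uv u0 vB /row_copid0 vq /row_pid0 vi]]]|[v [v0 vB vc]]].
  have {}u0 : u = 0.
    by apply/eqP; rewrite -submx0 (submx_trans u0) // [toprows 0 M]flatmx0 sub0mx.
  exists v; split; [by move: uv; rewrite u0 eqxx | by rewrite -(genmxE (toprows b M)) |].
  move=> c; rewrite mem_cat !mem_iota => /orP[ci|/andP[qc _]]; last exact: vq.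
  by have := vi c; rewrite u0 add0r; apply; lia.
exists 0, v; split; rewrite ?v0 ?orbT ?sub0mx ?genmxE ?add0r //.
  by apply/row_copid0 => c qc; apply: vc; rewrite mem_cat !mem_iota qc /= /q; have := ltn_ord c; lia.
by apply/row_pid0 => c ci; apply: vc; rewrite mem_cat !mem_iota ci.
Qed.

(** With B the whole space, v is free on the first [k] coordinates and can cancel u there; u is
    constrained only on the next [i - k] columns, as many as the rows. *)
Lemma plucker_above i : nr ns \in ns -> (nr ns < i < n)%N ->
  inproj (Richardson (simp n i) (wmul (w0 n) (wP n ns))) M <->
  plucker M (iota (i - nr ns).+1 (nr ns)) = 0.
Proof.
move=> ans iN; set a := nr ns; set k := (i - a)%N.
rewrite (@inproj_vectors a i n) ?ans ?orbT ?eqxx //; last first.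
  by move=> m /mem_ns/andP[_ ->].
rewrite subnn add0n -/k /upper_step eqxx iotaS.
rewrite plucker0P ?size_iota ?iota_ltn_sorted ?toprows_free //; last first.
  by apply/allP => c; rewrite mem_iota /k; lia.
split=> [[u [v [uv uA _ /row_copid0 vk /row_pid0 uvi]]]|[u [u0 uA uc]]].
  exists u; split=> //.
    apply: contraTneq uv => u0; rewrite u0 eqxx /= negbK; apply/eqP/rowP => c; rewrite [RHS]mxE.
    have [/vk //|ck] := leqP k c.
    by have := uvi c; rewrite u0 add0r; apply; rewrite /k in ck; lia.
  move=> c; rewrite mem_iota => /andP[kc ci]; have := uvi c; rewrite mxE vk // addr0.
  by apply; rewrite /k in ci; lia.
(* v is minus the truncation of u to the first [k] coordinates. *)
exists u, (- u *m (pid_mx k : 'M[C]_n)); split; rewrite ?u0 ?submx1 //.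
  by rewrite -mulmxA pid_copid mulmx0.
apply/row_pid0 => c ci; rewrite pid_diagE mul_mx_diag !mxE.
case: ltnP => ck; first by rewrite mulr1 subrr.
by rewrite mulr0 addr0 uc // mem_iota ck /k; lia.
Qed.

Lemma plucker_between i a b : a \in ns -> b \in ns ->
  (forall m, m \in ns -> (m <= a)%N || (b <= m)%N) -> (a < i < b)%N ->
  let k := (i - a)%N in let l := minn i (n - b + k) in
  inproj (Richardson (simp n i) (wmul (w0 n) (wP n ns))) M <->
  \sum_(J : {set 'I_l} | #|J| == k)
     (-1) ^+ (\sum_(x in J) (val x).+1) *
     plucker M [seq x <- iota 1 i | x \notin [seq (val y).+1 | y in J]] *
     plucker M ([seq (val y).+1 | y in J] ++ iota (n - b + k).+1 (b - k)) = 0.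
Proof.
move=> ans bns gap aib k l; have /andP[_ br] := mem_ns bns; have bltn := leq_ltn_trans br ns_lt.
have ar : (a <= nr ns)%N by lia.
rewrite (@inproj_vectors a i b) ?ans ?bns ?orbT //.
have -> : upper_step b = <<toprows b M>>%MS by rewrite /upper_step (ltn_eqF bltn).
have := @laplace_kernel _ n _ M a b i aib (ltnW bltn) (toprows_free ar) (toprows_free br).
rewrite -/k -/l /= => lk.
rewrite (_ : (exists u v, _) <-> detf (a + b) (laplace_mx (mget M) (mget M) a i l (n - b + k)) = 0); last first.
  by rewrite lk; split=> -[u [v [uv uA vB vq uvi]]]; exists u, v; split=> //; move: vB; rewrite genmxE.
have li : (l <= i)%N by rewrite /l; lia.
have lq : (l <= n - b + k)%N by rewrite /l; lia.
have ai : (a <= i)%N by case/andP: aib => /ltnW.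
have kb : (i - a <= b)%N by move: aib; clear; lia.
have -> := laplace_expansion (mget M) (mget M) (n - b + k) ai kb li.
rewrite -/k.
(* The sign common to all [J] is a unit and does not affect the zero locus. *)
set e := (-1) ^+ (k + _ + _); set s1 := (X in e * X = _); set s2 := (X in _ <-> X = _).
suff -> : s1 = s2.
  split=> [/eqP|->]; last by rewrite mulr0.
  by rewrite mulf_eq0 signr_eq0 => /eqP.
apply: eq_bigr => J /eqP Jk; set t := [seq val y | y in J].
have tE : [seq (val y).+1 | y in J] = map S t by rewrite /t /image_mem -map_comp.
have tl x : x \in t -> (x < l)%N by move=> /mapP[y _ ->]; exact: ltn_ord.
have st : sorted ltn t.
  rewrite /t -(filter_iota_image J li).
  exact: (sorted_filter ltn_trans _ (iota_ltn_sorted 0 i)).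
have szt : size t = k by rewrite /t size_image.
congr (_ * _ * _).
  have -> : [seq x <- iota 1 i | x \notin [seq (val y).+1 | y in J]] =
      map S [seq x <- iota 0 i | x \notin t].
    by rewrite iotaS filter_map tE; congr map; apply: eq_filter => x /=; rewrite mem_map //; exact: succn_inj.
  rewrite pluckerE; last exact: (sorted_filter ltn_trans _ (iota_ltn_sorted 0 i)).
  suff -> : size [seq x <- iota 0 i | x \notin t] = a by [].
  rewrite size_filter; have := count_predC (mem t) (iota 0 i).
  rewrite -size_filter (filter_iota_image J li) -/t szt size_iota /k => cE.
  by move: cE aib; rewrite /=; move: (count _ _); lia.
rewrite tE iotaS -map_cat pluckerE.
  by rewrite size_cat szt size_iota subnKC //; lia.
apply: sorted_ltn_cat; rewrite ?iota_ltn_sorted // => x y /tl xl.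
by rewrite mem_iota => /andP[qy _]; exact: leq_trans xl (leq_trans lq qy).
Qed.
End Point.
End Assembly.

Theorem theorem4p1 (R : realType) (n : nat) (ns : seq nat) (i : nat) :
  ns != [::] -> sorted ltn ns -> (0 < head 0 ns)%N -> (last 0 ns < n)%N ->
  (0 < i < n)%N ->
  let C := R[i]%C in
  let nj := fun j : nat => nth 0%N ns j.-1 in
  let r := size ns in
  let s := simp n i in
  (* (1) *)
  [/\ (i \in ns ->
        given_by (Richardson 1%g (wmul (wmul (w0 n) s) (wP n ns)))
          (fun M : 'M[C]_(nr ns, n) => plucker M (iota (n - i).+1 i))),
  (* (2) *)
      (i \in ns ->
        given_by (Richardson s (wmul (w0 n) (wP n ns)))
          (fun M : 'M[C]_(nr ns, n) => plucker M (iota 1 i))),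
  (* (3) *)
      ((i < nj 1%N)%N ->
        given_by (Richardson s (wmul (w0 n) (wP n ns)))
          (fun M : 'M[C]_(nr ns, n) =>
             plucker M (iota 1 i ++ iota (n - nj 1%N + i).+1 (nj 1%N - i)))),
  (* (4) *)
      ((nj r < i)%N ->
        given_by (Richardson s (wmul (w0 n) (wP n ns)))
          (fun M : 'M[C]_(nr ns, n) => plucker M (iota (i - nj r).+1 (nj r))))
  (* (5) *)
    & (forall j : nat, (1 <= j <= r - 1)%N -> (nj j < i < nj j.+1)%N ->
        let k := (i - nj j)%N in
        let l := minn i (n - nj j.+1 + k) in
        given_by (Richardson s (wmul (w0 n) (wP n ns)))
          (fun M : 'M[C]_(nr ns, n) =>
             \sum_(J : {set 'I_l} | #|J| == k)
               (-1) ^+ (\sum_(a in J) (val a).+1) *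
               plucker M [seq a <- iota 1 i | a \notin [seq (val b).+1 | b in J]] *
               plucker M ([seq (val b).+1 | b in J] ++
                          iota (n - nj j.+1 + k).+1 (nj j.+1 - k))))].
Proof.
move=> ns0 ns_sorted ns_pos ns_lt iN C nj r s.
have n0 : (0 < n)%N by case/andP: iN => i0; exact: ltn_trans.
have r0 : (0 < size ns)%N by case: (ns) ns0.
have mono j k : (j <= k)%N -> (k < size ns)%N -> (nth 0%N ns j <= nth 0%N ns k)%N.
  move=> jk kr; apply: (sorted_leq_nth leq_trans leqnn) => //; rewrite ?inE //.
    by apply: sub_sorted ns_sorted => x y /ltnW.
  exact: leq_ltn_trans kr.
have nthP m : m \in ns -> exists2 j, (j < size ns)%N & nth 0%N ns j = m.
  by move=> mns; exists (index m ns); rewrite ?index_mem ?nth_index.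
split.
- by move=> ins M rM; apply: Xup_schubert_divisor => //; case/andP: iN.
- by move=> ins M rM; apply: Xlow_schubert_divisor => //; case/andP: iN.
- move=> inj M rM; apply: plucker_below => //; first exact: mem_nth.
    by move=> m /nthP[j jr <-]; exact: mono.
  by rewrite inj andbT; case/andP: iN.
- have -> : nj r = nr ns by rewrite /nj /r nth_last.
  move=> ri M rM; apply: plucker_above => //; last by rewrite ri; case/andP: iN.
  by rewrite /nr -nth_last mem_nth // prednK.
move=> j /andP[j0 jr] nij k l M rM.
have jlt : (j < size ns)%N by rewrite -(subnK r0) addn1 ltnS.
have j1lt : (j.-1 < size ns)%N := leq_ltn_trans (leq_pred j) jlt.
apply: plucker_between => //; try exact: mem_nth.
move=> m /nthP[h hr <-]; have [hj|jh] := leqP h j.-1; first by rewrite mono.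
by rewrite orbC /nj mono //= -(prednK j0).
Qed.
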